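(* Let $F\in\boldsymbol{D}_S$ and $F_n\in\boldsymbol{D}_S$, $n\in\mathbb{N}$. Let $X$ and $X_n$ be the sets of all points of growth of $F$ and $F_n$, and let $\gamma$, $(\lambda_u)$ and $\gamma_n$, $(\lambda_{n,u})$ be the parameters of the spectral representations of the characteristic functions of $F$ and $F_n$, respectively (as specified in the context), with $\lambda_u=0$ for $u\notin\langle X\rangle$ and $\lambda_{n,u}=0$ for $u\notin\langle X_n\rangle$. Then $F_n$ converges in variation to $F$ as $n\to\infty$ if and only if both of the following conditions hold: (i) there exists $n_0\in\mathbb{N}$ such that $\gamma_n=\gamma$ for all $n\geqslant n_0$; (ii) $\displaystyle\sum_{u\in\langle X_n\rangle\cup\langle X\rangle,\ u\ne0}|\lambda_{n,u}-\lambda_u|\to0$ as $n\to\infty$.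
   Context: A discrete distribution function is a function $F(x)=\sum_{k=1}^\infty p_{x_k}I_{x_k}(x)$, $x\in\mathbb{R}$, with distinct real $x_k$, $p_{x_k}\geqslant0$, $\sum_{k=1}^\infty p_{x_k}=1$, where $I_c(x)=1$ if $x\geqslant c$ and $I_c(x)=0$ if $x<c$; its set of points of growth is $X=\{x_k: p_{x_k}>0\}$. $\boldsymbol{D}_S$ is the class of all discrete distribution functions $F$ whose characteristic function $f(t)=\int_{\mathbb{R}}e^{itx}\,dF(x)$ is separated from zero, i.e. there exists $\mu>0$ such that $|f(t)|\geqslant\mu$ for all $t\in\mathbb{R}$. For $Y\subset\mathbb{R}$, $\langle Y\rangle=\bigl\{\sum_{k=1}^m c_ky_k: c_k\in\mathbb{Z},\ y_k\in Y,\ m\in\mathbb{N}\bigr\}$. Sums over the empty set equal zero. Spectral representation: for every $F\in\boldsymbol{D}_S$ with set of points of growth $X$, the characteristic function has a representation $$f(t)=\exp\Bigl\{it\gamma+\sum_{u\in\langle X\rangle\setminus\{0\}}\lambda_u(e^{itu}-1)\Bigr\},\quad t\in\mathbb{R},$$ with $\gamma\in\langle X\rangle$, $\lambda_u\in\mathbb{R}$, $\sum_{u\in\langle X\rangle\setminus\{0\}}|\lambda_u|<\infty$, and the parameters $\gamma$ and $\lambda_u$, $u\in\langle X\rangle\setminus\{0\}$, are uniquely determined by $f$. For $F_n\in\boldsymbol{D}_S$ with set of points of growth $X_n$, the corresponding parameters are denoted $\gamma_n\in\langle X_n\rangle$ and $\lambda_{n,u}\in\mathbb{R}$, $u\in\langle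 X_n\rangle\setminus\{0\}$, so that the characteristic function of $F_n$ is $f_n(t)=\exp\bigl\{it\gamma_n+\sum_{u\in\langle X_n\rangle\setminus\{0\}}\lambda_{n,u}(e^{itu}-1)\bigr\}$. $F_n$ converges in variation to $F$ if $\|F_n-F\|\to0$ as $n\to\infty$, where $\|\cdot\|$ denotes the total variation on $\mathbb{R}$. *)

(* Defs.v *)
From HB Require Import structures.
From mathcomp Require Import all_boot all_order all_algebra.
From mathcomp Require Import complex.
From mathcomp Require Import all_classical all_reals all_analysis.

Set Implicit Arguments.
Unset Strict Implicit.
Unset Printing Implicit Defensive.
Import Order.TTheory GRing.Theory Num.Theory.
Import numFieldNormedType.Exports.

Local Open Scope classical_set_scope.
Local Open Scope ring_scope.
Local Open Scope complex_scope.

Section complex_analysis.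
Context {R : realType}.

Definition cexp (z : R[i]) : R[i] :=
  (expR (complex.Re z))%:C * (cos (complex.Im z) +i* sin (complex.Im z)).

Definition cintegral d (T : measurableType d) (mu : {measure set T -> \bar R})
    (f : T -> R[i]) : R[i] :=
  (\int[mu]_x complex.Re (f x)) +i* (\int[mu]_x complex.Im (f x)).

(* Unordered sums, meaningful when [a] is absolutely summable over [A]. *)
Definition rsum (T : choiceType) (A : set T) (a : T -> R) : R :=
  fine (\esum_(i in A) ((EFin \o a)^\+ i) - \esum_(i in A) ((EFin \o a)^\- i))%E.

Definition csum (T : choiceType) (A : set T) (a : T -> R[i]) : R[i] :=
  rsum A (fun i => complex.Re (a i)) +i* rsum A (fun i => complex.Im (a i)).

End complex_analysis.

Section discrete_distribution_functions.
Context {R : realType}.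

(* Atoms may carry zero mass, so finitely many points of growth are allowed. *)
Record discrete_df := DiscreteDF {
  atom : nat -> R;
  mass : nat -> R;
  atom_inj : injective atom;
  mass_ge0 : forall k, 0 <= mass k;
  mass_sum1 : series mass @ \oo --> (1 : R) }.

Definition step (c y : R) : R := (c <= y)%R%:R.

Definition df (F : discrete_df) (y : R) : R :=
  limn (series (fun k => mass F k * step (atom F k) y)).

Definition growth_points (F : discrete_df) : set R :=
  [set atom F k | k in [set k | 0 < mass F k]].

Section df_cumulative.
Variable F : discrete_df.

Let term y k := mass F k * step (atom F k) y.

Let term_ge0 y k : 0 <= term y k.
Proof. by rewrite mulr_ge0 ?mass_ge0 ?ler0n. Qed.

Let term_le y k : term y k <= mass F k.
Proof. by rewrite /term /step; case: (_ <= y); rewrite ?mulr1 ?mulr0 ?mass_ge0. Qed.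

Lemma is_cvg_df y : cvgn (series (term y)).
Proof.
apply: (@series_le_cvg _ (term y) (mass F)) => //.
- exact: mass_ge0.
- by apply/cvg_ex; exists 1; exact: mass_sum1.
Qed.

Lemma df_nondecreasing : nondecreasing (df F).
Proof.
move=> a b ab; apply: ler_lim; [exact: is_cvg_df|exact: is_cvg_df|].
near=> n; apply: ler_sum => k _; rewrite ler_wpM2l ?mass_ge0// /step ler_nat.
by case: (lerP (atom F k) a) => // /le_trans ->.
Unshelve. all: by end_near. Qed.

Lemma df_right_continuous (a : R) : df F @ at_right a --> df F a.
Proof.
apply/cvgrPdist_le => e e0.
have [N hN] : exists N, 1 - series (mass F) N <= e.
  move/cvgrPdist_le : (@mass_sum1 F) => /(_ _ e0)[N _ /(_ N (leqnn N))] h.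
  by exists N; exact: le_trans (ler_norm _) h.
have le1 n : series (mass F) n <= 1.
  rewrite -(cvg_lim (@Rhausdorff R) (@mass_sum1 F)).
  apply: nondecreasing_cvgn_le; last by apply/cvg_ex; exists 1; exact: mass_sum1.
  by apply/nondecreasing_series => k _ _; exact: mass_ge0.
have small : \forall y \near at_right a, forall k, (k < N)%N -> term y k = term a k.
  elim: N {hN} => [|N IH]; first exact: filterE.
  have : \forall y \near at_right a, term y N = term a N.
    have [xa|ax] := lerP (atom F N) a.
      apply: filterS (nbhs_right_ge a) => y ay.
      by rewrite /term /step xa (le_trans xa ay).
    apply: filterS (nbhs_right_lt ax) => y yN.
    by rewrite /term /step !leNgt ax yN.
  apply: filterS2 IH => y IH yN k; rewrite ltnS leq_eqVlt => /predU1P[->//|].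
  exact: IH.
near=> y.
have termN : forall k, (k < N)%N -> term y k = term a k by near: y.
have ay : a <= y by near: y; exact: nbhs_right_ge.
rewrite distrC ger0_norm ?subr_ge0 ?df_nondecreasing// lerBlDr.
apply: limr_le; first exact: is_cvg_df.
near=> n.
have Nn : (N <= n)%N by near: n; exact: nbhs_infty_ge.
have -> : series (term y) n = series (term a) N + \sum_(N <= k < n) term y k.
  rewrite /series/= (big_cat_nat _ Nn)//=; congr (_ + _).
  by apply: eq_big_nat => k /andP[_ kN]; exact: termN.
rewrite addrC lerD//.
  apply: le_trans hN; rewrite lerBrDl; apply: le_trans (le1 n).
  rewrite /series/= [leRHS](big_cat_nat _ Nn)//= lerD2l.
  by apply: ler_sum => k _; exact: term_le.
apply: nondecreasing_cvgn_le; last exact: is_cvg_df.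
by apply/nondecreasing_series => k _ _; exact: term_ge0.
Unshelve. all: by end_near. Qed.

HB.instance Definition _ :=
  isCumulative.Build R _ R (df F) df_nondecreasing df_right_continuous.

End df_cumulative.

Definition charfun (F : discrete_df) (t : R) : R[i] :=
  cintegral (lebesgue_stieltjes_measure (df F)) (fun x => cexp ('i%C * (t * x)%:C)).

Definition separated_from_zero (f : R -> R[i]) :=
  exists2 mu : R, 0 < mu & forall t, mu%:C <= `|f t|.

Definition DS : set discrete_df := [set F | separated_from_zero (charfun F)].

Definition zspan (Y : set R) : set R :=
  [set z | exists m (c : 'I_m.+1 -> int) (y : 'I_m.+1 -> R),
     (forall k, Y (y k)) /\ z = \sum_(k < m.+1) y k *~ c k].

(* [lambda] is extended by zero outside of <X>; its value at 0 is irrelevant. *)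
Definition spectral_parameters (F : discrete_df) (gamma : R) (lambda : R -> R) :=
  let S := zspan (growth_points F) in
  [/\ S gamma,
      forall u, ~ S u -> lambda u = 0,
      summable (S `\ 0) (EFin \o lambda) &
      forall t, charfun F t =
        cexp ('i%C * (t * gamma)%:C +
              csum (S `\ 0)
                (fun u => (lambda u)%:C * (cexp ('i%C * (t * u)%:C) - 1)))].

Definition total_variationR (f : R -> R) : \bar R :=
  ereal_sup [set v | exists a b, a <= b /\ v = total_variation a b f].

Definition cvg_in_variation (Fn : nat -> discrete_df) (F : discrete_df) :=
  total_variationR (df (Fn n) \- df F) @[n --> \oo] --> 0%E.

End discrete_distribution_functions.
Arguments discrete_df : clear implicits.

(* Main.v *)
(* Write [f], [f_n] for the characteristic functions, [f = e^(it gamma) e^g] and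
[f_n = e^(it gamma_n) e^(g_n)], where [g], [g_n] are absolutely convergent
trigonometric sums.

If [gamma_n = gamma] and the coefficients of [g_n - g] tend to [0] in l^1, then
[f_n - f = f (e^(g_n - g) - 1)] tends to [0] uniformly. A coefficient of a
trigonometric sum is bounded by its sup norm, so the point masses converge, and
Scheffe's lemma upgrades this to convergence in variation.

Conversely, convergence in variation makes the point masses converge, hence, by
Scheffe's lemma, the coefficients of [f_n - f] tend to [0] in l^1. Since
[1/f = e^(-it gamma) e^(-g)] also has an absolutely convergent expansion, so do
those of [f_n/f - 1 = e^k - 1], with [k t = it (gamma_n - gamma) + g_n t - g t].
As [k] is continuous, vanishes at [0] and [e^k] is uniformly close to [1], [k] is
uniformly small; boundedness forces [gamma_n = gamma]. Newton's iteration then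
recovers [k] from [e^k - 1] with control of the l^1 norm of its coefficients. *)
Require Import Defs.
From mathcomp Require Import all_boot all_order all_algebra.
From mathcomp Require Import finmap complex ring lra.
From mathcomp Require Import all_classical all_reals all_analysis measurable_realfun.

Import Order.TTheory GRing.Theory Num.Theory.
Import numFieldNormedType.Exports.
Local Open Scope classical_set_scope.
Local Open Scope ring_scope.

Notation normc := Normc.normc.

(** * The real-valued modulus on [R[i]] *)

Section modulus.
Local Open Scope complex_scope.
Context {R : realType}.
Implicit Types z w : R[i].

Lemma normcE z : normc z = Num.sqrt (complex.Re z ^+ 2 + complex.Im z ^+ 2).
Proof. by case: z. Qed.

Lemma normc_ge0 z : 0 <= normc z.
Proof. by rewrite normcE sqrtr_ge0. Qed.

Lemma normc_le_sum (T : Type) (s : seq T) (P : pred T) (f : T -> R[i]) :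
  normc (\sum_(i <- s | P i) f i) <= \sum_(i <- s | P i) normc (f i).
Proof.
elim/big_ind2 : _ => //; first by rewrite Normc.normc0.
by move=> a b c d ab cd; rewrite (le_trans (le_normcD _ _)) ?lerD.
Qed.

Lemma normc_distC z w : normc (z - w) = normc (w - z).
Proof. by rewrite -[LHS]normcN opprB. Qed.

Lemma normc_dist_trans z w v : normc (z - v) <= normc (z - w) + normc (w - v).
Proof. by rewrite (le_trans _ (le_normcD _ _))// addrA subrK. Qed.

Lemma normc_le_dist z w : normc z <= normc (z - w) + normc w.
Proof. by rewrite (le_trans _ (le_normcD _ _))// subrK. Qed.

Lemma normc_real (x : R) : normc x%:C = `|x|.
Proof. by rewrite /= expr0n addr0 sqrtr_sqr. Qed.

Lemma normcX z n : normc (z ^+ n) = normc z ^+ n.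
Proof.
by elim: n => [|n IH]; rewrite ?expr0 ?Normc.normc1// !exprS Normc.normcM IH.
Qed.

Lemma normr_Re_le z : `|complex.Re z| <= normc z.
Proof. by rewrite normcE -sqrtr_sqr ler_wsqrtr// lerDl sqr_ge0. Qed.

Lemma normr_Im_le z : `|complex.Im z| <= normc z.
Proof. by rewrite normcE -sqrtr_sqr ler_wsqrtr// lerDr sqr_ge0. Qed.

Lemma normc_le_ReIm z : normc z <= `|complex.Re z| + `|complex.Im z|.
Proof.
rewrite normcE -[leRHS]ger0_norm ?addr_ge0// -sqrtr_sqr ler_wsqrtr//.
by rewrite sqrrD !real_normK ?num_real// lerD2r lerDl mulrn_wge0 ?mulr_ge0.
Qed.

Lemma ReB z w : complex.Re (z - w) = complex.Re z - complex.Re w.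
Proof. by case: z w => [a b] [c d]. Qed.

Lemma ImB z w : complex.Im (z - w) = complex.Im z - complex.Im w.
Proof. by case: z w => [a b] [c d]. Qed.

Lemma Re_sum (T : Type) (s : seq T) (P : pred T) (f : T -> R[i]) :
  complex.Re (\sum_(i <- s | P i) f i) = \sum_(i <- s | P i) complex.Re (f i).
Proof. by apply: (big_morph _ _ erefl) => -[a b] [c d]. Qed.

Lemma Im_sum (T : Type) (s : seq T) (P : pred T) (f : T -> R[i]) :
  complex.Im (\sum_(i <- s | P i) f i) = \sum_(i <- s | P i) complex.Im (f i).
Proof. by apply: (big_morph _ _ erefl) => -[a b] [c d]. Qed.

End modulus.

(** * Truncated exponential series and their defect of multiplicativity *)

Section complex_exponential.
Local Open Scope complex_scope.
Context {R : realType}.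
Implicit Types z w : R[i].

Lemma cexpD z w : cexp (z + w) = cexp z * cexp w.
Proof.
case: z w => [a b] [c d]; rewrite /cexp /= expRD cosD sinD.
by apply/eqP; rewrite eq_complex /=; apply/andP; split; apply/eqP; ring.
Qed.

Lemma cexp0 : cexp 0 = 1 :> R[i].
Proof. by rewrite /cexp/= expR0 cos0 sin0; simpc. Qed.

Lemma normc_cexp z : normc (cexp z) = expR (complex.Re z).
Proof.
rewrite /cexp Normc.normcM normc_real ger0_norm ?expR_ge0//=.
by rewrite cos2Dsin2 sqrtr1 mulr1.
Qed.

Lemma normc_cexp_imag (x : R) : normc (cexp ('i * x%:C)) = 1.
Proof. by rewrite normc_cexp /=; rewrite !mul0r mulr0 subrr expR0. Qed.

Definition exp_sum {K : fieldType} (n : nat) (x : K) : K :=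
  \sum_(k < n) x ^+ k / k`!%:R.

(** Stores the terms of [exp_sum n x] as coefficients, so that the Cauchy product of two truncated
    series is a product of polynomials. *)
Definition exp_poly {K : fieldType} (n : nat) (x : K) : {poly K} :=
  \poly_(k < n) (x ^+ k / k`!%:R).

Lemma horner_exp_poly {K : fieldType} n (x : K) : (exp_poly n x).[1] = exp_sum n x.
Proof.
by rewrite horner_poly; apply: eq_bigr => i _; rewrite expr1n mulr1.
Qed.

Lemma coef_exp_polyM {K : numFieldType} n m (x y : K) : (m < n)%N ->
  (exp_poly n x * exp_poly n y)`_m = (x + y) ^+ m / m`!%:R.
Proof.
move=> mn; rewrite coefM addrC exprDn mulr_suml; apply: eq_bigr => -[i /= im _].
rewrite !coef_poly (leq_ltn_trans _ mn)// (leq_ltn_trans (leq_subr _ _) mn).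
rewrite -(@bin_fact m i)// -mulr_natr !natrM; field.
by rewrite !pnatr_eq0 -!lt0n !fact_gt0 bin_gt0.
Qed.

(** Below degree [n] the Cauchy product agrees with the binomial formula and cancels; only the
    higher coefficients survive. *)
Lemma exp_sumM {K : numFieldType} n (x y : K) :
  exp_sum n x * exp_sum n y - exp_sum n (x + y) =
  \sum_(n <= m < n + n) (exp_poly n x * exp_poly n y)`_m.
Proof.
rewrite -!horner_exp_poly -hornerM.
rewrite (@horner_coef_wide _ (n + n)); last first.
  rewrite (leq_trans (size_polyMleq _ _))// (leq_trans (leq_pred _))//.
  by rewrite leq_add ?size_poly.
rewrite -(big_mkord xpredT (fun i => _`_i * 1 ^+ i)).
rewrite (@big_cat_nat _ _ _ n)//= ?leq_addr// horner_exp_poly addrAC.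
rewrite -[RHS]add0r; congr (_ + _).
  apply/eqP; rewrite subr_eq0 big_mkord; apply/eqP; apply: eq_bigr => i _.
  by rewrite expr1n mulr1 coef_exp_polyM.
by apply: eq_bigr => i _; rewrite expr1n mulr1.
Qed.

Lemma natrC n : (n%:R : R[i]) = (n%:R : R)%:C.
Proof. by rewrite rmorph_nat. Qed.

Lemma normcVnat n : normc (n%:R^-1 : R[i]) = n%:R^-1.
Proof. by rewrite Normc.normcV natrC normc_real ger0_norm. Qed.

(** The surviving coefficients are polynomials in [z] and [w] with nonnegative coefficients, so the
    triangle inequality replaces both variables by their moduli. *)
Lemma normc_exp_sumM n z w :
  normc (exp_sum n z * exp_sum n w - exp_sum n (z + w)) <=
  exp_sum n (normc z) * exp_sum n (normc w) - exp_sum n (normc z + normc w).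
Proof.
rewrite !exp_sumM (le_trans (normc_le_sum _ _ _ _))//; apply: ler_sum => m _.
rewrite !coefM (le_trans (normc_le_sum _ _ _ _))//; apply: ler_sum => j _.
rewrite !coef_poly Normc.normcM; case: ifP => _; case: ifP => _;
  rewrite ?Normc.normc0 ?mulr0 ?mul0r// !Normc.normcM !normcVnat !normcX//.
Qed.

End complex_exponential.

(** * Power series of [cexp] and bounds for its remainders *)

Section complex_exponential_series.
Local Open Scope complex_scope.
Context {R : realType}.
Implicit Types z w : R[i].

Lemma exp_sum_series (x : R) n : exp_sum n x = series (exp_coeff x) n.
Proof. by rewrite /exp_sum /series/= big_mkord. Qed.

Lemma cvg_exp_sum (x : R) : exp_sum n x @[n --> \oo] --> expR x.
Proof.
rewrite (_ : (fun n => exp_sum n x) = series (exp_coeff x)).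
  exact: is_cvg_series_exp_coeff.
by apply/funext => n; exact: exp_sum_series.
Qed.

Lemma exp_sum_le_expR (x : R) n : 0 <= x -> exp_sum n x <= expR x.
Proof.
move=> x0; rewrite exp_sum_series.
apply: nondecreasing_cvgn_le; last exact: is_cvg_series_exp_coeff.
by apply/nondecreasing_series => k _ _; exact: exp_coeff_ge0.
Qed.

Lemma exp_sum_real (x : R) n : exp_sum n x%:C = (exp_sum n x)%:C.
Proof.
rewrite /exp_sum rmorph_sum; apply: eq_bigr => k _ /=.
by rewrite rmorphM rmorphXn/= fmorphV rmorph_nat.
Qed.

Lemma exp_sum_imag (y : R) n : exp_sum n ('i * y%:C) =
  series (cos_coeff y) n +i* series (sin_coeff y) n.
Proof.
rewrite /exp_sum /series/= !big_mkord; apply/eqP.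
rewrite eq_complex Re_sum Im_sum /=.
have E (k : 'I_n) : ('i * y%:C) ^+ k / k`!%:R = cos_coeff y k +i* sin_coeff y k.
  rewrite /cos_coeff /sin_coeff/= exprMn -[LHS]mulrA.
  (* Powers of ['i] written with the parity factors and signs that occur in [cos_coeff] and
     [sin_coeff]; for odd [k] the two halves [k.-1./2] and [k./2] coincide. *)
  have -> : 'i ^+ k = ((~~ odd k)%:R * (-1) ^+ k./2) +i* ((odd k)%:R * (-1) ^+ k.-1./2) :> R[i].
    rewrite -{1}(odd_double_half k) exprD -mul2n exprM sqr_i.
    have -> : (-1) ^+ k./2 = ((-1) ^+ k./2)%:C :> R[i].
      by rewrite rmorphXn/= rmorphN1.
    have [ok|ok] := boolP (odd k).
      have -> : k.-1./2 = k./2.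
        by rewrite -{1}(odd_double_half k) ok add1n/= doubleK.
      by rewrite expr1; simpc.
    by rewrite expr0; simpc.
  have -> : y%:C ^+ k / k`!%:R = (y ^+ k / k`!%:R)%:C :> R[i].
    by rewrite rmorphM rmorphXn fmorphV/= rmorph_nat.
  by apply/eqP; rewrite eq_complex/= !mulr0 !subr0 add0r !mulrA !eqxx.
by apply/andP; split; apply/eqP; apply: eq_bigr => k _; rewrite E.
Qed.

(** Links [cexp], built from [expR], [cos] and [sin], to its power series. The product [u n] of the
    partial sums at the real and the imaginary part converges by the three real series; replacing it
    by the partial sum at [z] costs at most the real defect at [|x|], [|y|], which tends to zero. *)
Lemma cvg_cexp z : normc (cexp z - exp_sum n z) @[n --> \oo] --> (0 : R).
Proof.
pose x := complex.Re z; pose y := complex.Im z.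
have zE : z = x%:C + 'i * y%:C by rewrite [LHS]complexE.
pose u n : R[i] := exp_sum n x%:C * exp_sum n ('i * y%:C).
have cosE : series (cos_coeff y) @ \oo --> cos y.
  by rewrite unlock; exact: is_cvg_series_cos_coeff.
have sinE : series (sin_coeff y) @ \oo --> sin y.
  by rewrite unlock; exact: is_cvg_series_sin_coeff.
have cu : normc (cexp z - u n) @[n --> \oo] --> (0 : R).
  apply: (@squeeze_cvgr _ _ _ _ (cst 0) (fun n =>
    `|expR x * cos y - exp_sum n x * series (cos_coeff y) n| +
    `|expR x * sin y - exp_sum n x * series (sin_coeff y) n|)).
  - apply: nearW => n; rewrite normc_ge0/=.
    rewrite (le_trans (normc_le_ReIm _))// ReB ImB /u exp_sum_real exp_sum_imag.
    by rewrite /cexp/= !mul0r !subr0 !addr0.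
  - exact: cvg_cst.
  - rewrite -[0]addr0 -(@normr0 _ R).
    apply: cvgD; apply: cvg_norm.
    + rewrite -(subrr (expR x * cos y)); apply: cvgB; first exact: cvg_cst.
      exact: cvgM (cvg_exp_sum _) cosE.
    + rewrite -(subrr (expR x * sin y)); apply: cvgB; first exact: cvg_cst.
      exact: cvgM (cvg_exp_sum _) sinE.
have cv : exp_sum n `|x| * exp_sum n `|y| - exp_sum n (`|x| + `|y|)
    @[n --> \oo] --> (0 : R).
  rewrite -(subrr (expR (`|x| + `|y|))) {1}expRD.
  apply: cvgB (cvg_exp_sum _).
  exact: cvgM (cvg_exp_sum _) (cvg_exp_sum _).
apply: (@squeeze_cvgr _ _ _ _ (cst 0) (fun n => normc (cexp z - u n) +
  (exp_sum n `|x| * exp_sum n `|y| - exp_sum n (`|x| + `|y|)))).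
- apply: nearW => n; rewrite normc_ge0/=.
  rewrite (le_trans (normc_dist_trans _ (u n) _))// lerD2l [in X in _ - X]zE.
  rewrite (le_trans (normc_exp_sumM _ _ _))//.
  by rewrite Normc.normcM !normc_real /= expr0n expr1n add0r sqrtr1 mul1r.
- exact: cvg_cst.
- by rewrite -[0]addr0; exact: cvgD.
Qed.

(** Up to [e], [cexp z] is a longer partial sum; the remaining block of terms is dominated termwise
    by the same block at [c]. *)
Lemma normc_cexp_sub_le z c n : normc z <= c ->
  normc (cexp z - exp_sum n z) <= expR c - exp_sum n c.
Proof.
move=> zc; have c0 := le_trans (normc_ge0 z) zc.
apply/ler_addgt0Pr => e e0.
have /cvgrPdist_le /(_ _ e0)[N _ hN] := cvg_cexp z.
have /hN := leq_addr n N; rewrite /= sub0r normrN ger0_norm ?normc_ge0// => h.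
rewrite (le_trans (normc_dist_trans _ (exp_sum (N + n) z) _))// addrC lerD//.
apply: (@le_trans _ _ (exp_sum (N + n) c - exp_sum n c)); last first.
  by rewrite lerD2r exp_sum_le_expR.
rewrite addnC /exp_sum !big_split_ord/= !(addrAC _ (\sum_(i < N) _)) !subrr !add0r.
rewrite (le_trans (normc_le_sum _ _ _ _))//; apply: ler_sum => i _.
rewrite Normc.normcM normcVnat normcX ler_wpM2r ?invr_ge0//.
by rewrite lerXn2r ?nnegrE ?normc_ge0.
Qed.

(** From [e^(-c) >= 1 - c] one gets [e^c <= 1/(1 - c)], and
    [1/(1 - c) - 1 - c = c^2/(1 - c) <= 2c^2]. *)
Lemma expR_sub1_le (c : R) : 0 <= c <= 2^-1 -> expR c - 1 - c <= 2 * c ^+ 2.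
Proof.
move=> /andP[c0 c2].
have := expR_ge1Dx (- c); have := expRxMexpNx_1 c; have := expR_gt0 c.
set a := expR c; set b := expR (- c) => a0 ab1 hb.
have : a * (1 - c) <= 1 by rewrite -[leRHS]ab1 ler_pM2l.
move=> h; rewrite -subr_ge0 -(@pmulr_lge0 _ (1 - c)); last by lra.
have : 0 <= c ^+ 2 * (1 - 2 * c) by rewrite mulr_ge0 ?sqr_ge0//; lra.
by nra.
Qed.

Lemma normc_cexp1_le z : normc z <= 2^-1 ->
  normc (cexp z - 1 - z) <= 2 * normc z ^+ 2.
Proof.
move=> z2; apply: le_trans (expR_sub1_le (normc z) _); last by rewrite normc_ge0.
have := @normc_cexp_sub_le z _ 2 (lexx _).
by rewrite /exp_sum !big_ord_recl !big_ord0/= !addr0 !expr0 !expr1 !divr1 !opprD !addrA.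
Qed.

End complex_exponential_series.

(** * The algebra of absolutely convergent trigonometric sums *)

Section absolutely_convergent_trigonometric_sums.
Local Open Scope complex_scope.
Context {R : realType}.
Implicit Types (P Q : seq (R * R)) (g h : R -> R[i]) (c d : R).

Definition expi (x t : R) : R[i] := cexp ('i * (t * x)%:C).

(** [P] lists pairs (coefficient, frequency). Frequencies may repeat, so [trig_norm P] only bounds
    the l^1 norm of the coefficients from above. *)
Definition trig_eval P t : R[i] := \sum_(q <- P) q.1%:C * expi q.2 t.

Definition trig_norm P : R := \sum_(q <- P) `|q.1|.

(* The functions [sum_u a_u e^(itu)] with real [a_u] and [sum_u |a_u| <= c].
Describing them as uniform limits of trigonometric polynomials avoids all
rearrangements of infinite sums. *)
Definition wiener c g := forall e, 0 < e ->
  exists2 P, trig_norm P <= c & forall t, normc (g t - trig_eval P t) <= e.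

Lemma expiD x y t : expi (x + y) t = expi x t * expi y t.
Proof. by rewrite /expi mulrDr rmorphD mulrDr cexpD. Qed.

Lemma expiDt x s t : expi x (s + t) = expi x s * expi x t.
Proof. by rewrite /expi mulrDl rmorphD mulrDr cexpD. Qed.

Lemma expi0 t : expi 0 t = 1.
Proof. by rewrite /expi mulr0 mulr0 cexp0. Qed.

Lemma expi_0 x : expi x 0 = 1.
Proof. by rewrite /expi mul0r mulr0 cexp0. Qed.

Lemma normc_expi x t : normc (expi x t) = 1.
Proof. exact: normc_cexp_imag. Qed.

Lemma Re_expi (x t : R) : complex.Re (expi x t) = cos (t * x).
Proof.
by rewrite /expi /cexp/= !(mul0r, mul1r, mulr0, subr0, add0r, addr0, oppr0, expR0).
Qed.

Lemma Im_expi (x t : R) : complex.Im (expi x t) = sin (t * x).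
Proof.
by rewrite /expi /cexp/= !(mul0r, mul1r, mulr0, subr0, add0r, addr0, oppr0, expR0).
Qed.

Lemma normc_trig_eval P t : normc (trig_eval P t) <= trig_norm P.
Proof.
rewrite (le_trans (normc_le_sum _ _ _ _))//; apply: ler_sum => q _.
by rewrite Normc.normcM normc_expi mulr1 normc_real.
Qed.

Lemma wiener_le c d g : c <= d -> wiener c g -> wiener d g.
Proof. by move=> cd Wg e /Wg[P Pc Pg]; exists P => //; exact: le_trans cd. Qed.

Lemma wiener_bound c g t : wiener c g -> normc (g t) <= c.
Proof.
move=> Wg; apply/ler_addgt0Pr => e /Wg[P Pc Pg].
rewrite (le_trans (normc_le_dist _ (trig_eval P t)))// addrC lerD//.
exact: le_trans (normc_trig_eval _ _) Pc.
Qed.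

Lemma wiener_ge0 c g : wiener c g -> 0 <= c.
Proof. by move=> /(wiener_bound _ _ 0); apply: le_trans; exact: normc_ge0. Qed.

Lemma wiener_trig P : wiener (trig_norm P) (trig_eval P).
Proof.
by move=> e e0; exists P => // t; rewrite subrr Normc.normc0 ltW.
Qed.

Lemma wiener_expi x : wiener 1 (expi x).
Proof.
rewrite (_ : expi x = trig_eval [:: (1, x)]).
  by apply: wiener_le (wiener_trig _); rewrite /trig_norm big_seq1/= normr1.
by apply/funext => t; rewrite /trig_eval big_seq1/= mul1r.
Qed.

Lemma wiener_cst (a : R) : wiener `|a| (fun=> a%:C).
Proof.
rewrite (_ : (fun=> _) = trig_eval [:: (a, 0)]).
  by apply: wiener_le (wiener_trig _); rewrite /trig_norm big_seq1.
by apply/funext => t; rewrite /trig_eval big_seq1/= expi0 mulr1.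
Qed.

Lemma wiener0 : wiener 0 (fun=> 0).
Proof. by have := wiener_cst 0; rewrite normr0. Qed.

Lemma wienerD c d g h : wiener c g -> wiener d h -> wiener (c + d) (fun t => g t + h t).
Proof.
move=> Wg Wh e e0; have e2 : 0 < e / 2 by rewrite divr_gt0.
have [P Pc Pg] := Wg _ e2; have [Q Qc Qh] := Wh _ e2.
exists (P ++ Q); first by rewrite /trig_norm big_cat lerD.
move=> t; rewrite /trig_eval big_cat/= opprD addrACA [leRHS]splitr.
by rewrite (le_trans (le_normcD _ _))// lerD.
Qed.

Lemma trig_evalM P Q t : trig_eval P t * trig_eval Q t =
  trig_eval [seq (p.1 * q.1, p.2 + q.2) | p <- P, q <- Q] t.
Proof.
rewrite /trig_eval big_allpairs_dep mulr_suml; apply: eq_bigr => p _.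
by rewrite mulr_sumr; apply: eq_bigr => q _ /=; rewrite expiD rmorphM mulrACA.
Qed.

Lemma trig_normM P Q :
  trig_norm [seq (p.1 * q.1, p.2 + q.2) | p <- P, q <- Q] = trig_norm P * trig_norm Q.
Proof.
rewrite /trig_norm big_allpairs_dep mulr_suml; apply: eq_bigr => p _.
by rewrite mulr_sumr; apply: eq_bigr => q _ /=; rewrite normrM.
Qed.

Lemma trig_norm_ge0 P : 0 <= trig_norm P.
Proof. by apply: sumr_ge0 => q _. Qed.

Lemma wienerM c d g h : wiener c g -> wiener d h -> wiener (c * d) (fun t => g t * h t).
Proof.
move=> Wg Wh e e0; have c0 := wiener_ge0 _ _ Wg; have d0 := wiener_ge0 _ _ Wh.
(* If each factor is approximated up to [e2], the product is off by at most [e2 * (c + d)]; the [1]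
   keeps the divisor positive. *)
have cd0 : 0 < c + d + 1 by rewrite ltr_wpDl// addr_ge0.
have e2 : 0 < e / (c + d + 1) by rewrite divr_gt0.
have [P Pc Pg] := Wg _ e2; have [Q Qc Qh] := Wh _ e2.
exists [seq (p.1 * q.1, p.2 + q.2) | p <- P, q <- Q].
  by rewrite trig_normM ler_pM ?trig_norm_ge0.
move=> t; rewrite -trig_evalM.
have -> : g t * h t - trig_eval P t * trig_eval Q t =
    (g t - trig_eval P t) * h t + trig_eval P t * (h t - trig_eval Q t) by ring.
rewrite (le_trans (le_normcD _ _))// !Normc.normcM.
rewrite (@le_trans _ _ (e / (c + d + 1) * d + c * (e / (c + d + 1))))//.
  rewrite lerD// ler_pM ?normc_ge0//; first exact: wiener_bound.
  exact: le_trans (normc_trig_eval _ _) Pc.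
rewrite [c * _]mulrC -mulrDr -mulrA ler_piMr ?(ltW e0)// mulrC ler_pdivrMr//.
lra.
Qed.

Lemma wienerZ (a : R) c g : wiener c g -> wiener (`|a| * c) (fun t => a%:C * g t).
Proof. exact/wienerM/wiener_cst. Qed.

Lemma wienerN c g : wiener c g -> wiener c (fun t => - g t).
Proof.
move=> /(wienerZ (-1)); rewrite normrN normr1 mul1r.
by under eq_fun do rewrite rmorphN1 mulN1r.
Qed.

Lemma wienerB c d g h : wiener c g -> wiener d h -> wiener (c + d) (fun t => g t - h t).
Proof. by move=> Wg /wienerN; exact: wienerD. Qed.

Lemma wienerX c g n : wiener c g -> wiener (c ^+ n) (fun t => g t ^+ n).
Proof.
move=> Wg; elim: n => [|n IH].
  by have := wiener_cst 1; rewrite normr1.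
by rewrite exprS; under eq_fun do rewrite exprS; exact: wienerM.
Qed.

Lemma wiener_sum n (c : 'I_n -> R) (g : 'I_n -> R -> R[i]) :
  (forall i, wiener (c i) (g i)) -> wiener (\sum_i c i) (fun t => \sum_i g i t).
Proof.
elim: n c g => [|n IH] c g Wg.
  rewrite big_ord0 (_ : (fun t => _) = fun=> 0); first exact: wiener0.
  by apply/funext => t; rewrite big_ord0.
rewrite big_ord_recl.
rewrite (_ : (fun t => _) = fun t => g ord0 t + \sum_i g (lift ord0 i) t).
  exact/wienerD/IH.
by apply/funext => t; rewrite big_ord_recl.
Qed.

Lemma wiener_lim c g :
  (forall e, 0 < e -> exists2 h, wiener c h & forall t, normc (g t - h t) <= e) ->
  wiener c g.
Proof.
move=> Wg e e0; have e2 : 0 < e / 2 by rewrite divr_gt0.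
have [h Wh gh] := Wg _ e2; have [P Pc hP] := Wh _ e2.
exists P => // t; rewrite (le_trans (normc_dist_trans _ (h t) _))//.
by rewrite [leRHS]splitr lerD.
Qed.

(** The term [g^k / k!] has Wiener bound [c^k / k!]. Finite blocks of the tail therefore stay below
    the tail of [expR c], and they converge uniformly because [|g| <= c]. *)
Lemma wiener_exp_sub m c g : wiener c g ->
  wiener (expR c - exp_sum m c) (fun t => cexp (g t) - exp_sum m (g t)).
Proof.
move=> Wg; have c0 := wiener_ge0 _ _ Wg; apply: wiener_lim => e e0.
have /cvgrPdist_le /(_ _ e0)[N _ hN] := cvg_exp_sum c.
have /hN /= {}hN := leq_addl m N.
exists (fun t => \sum_(k < N) (((m + k)`!%:R : R)^-1)%:C * g t ^+ (m + k)).
  apply: (@wiener_le (\sum_(k < N) `|((m + k)`!%:R : R)^-1| * c ^+ (m + k))).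
    rewrite -(lerD2r (exp_sum m c)) subrK.
    rewrite (le_trans _ (@exp_sum_le_expR _ _ (m + N) c0))//.
    rewrite addrC /exp_sum big_split_ord/= lerD2l; apply: ler_sum => k _.
    by rewrite ger0_norm// mulrC.
  by apply: wiener_sum => k; exact/wienerZ/wienerX.
move=> t.
have -> : cexp (g t) - exp_sum m (g t) -
    \sum_(k < N) (((m + k)`!%:R : R)^-1)%:C * g t ^+ (m + k) =
    cexp (g t) - exp_sum (m + N) (g t).
  rewrite /exp_sum big_split_ord/= opprD addrA; congr (_ - _).
  by apply: eq_bigr => k _; rewrite fmorphV/= rmorph_nat mulrC.
rewrite (le_trans (@normc_cexp_sub_le _ _ c _ _))//; first exact: wiener_bound.
exact: le_trans (ler_norm _) hN.
Qed.

Lemma wiener_exp c g : wiener c g -> wiener (expR c) (fun t => cexp (g t)).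
Proof.
move=> /(wiener_exp_sub 0); rewrite /exp_sum big_ord0 subr0.
by under eq_fun do rewrite big_ord0 subr0.
Qed.

Lemma wiener_exp1 c g : c <= 2^-1 -> wiener c g ->
  wiener (2 * c ^+ 2) (fun t => cexp (g t) - 1 - g t).
Proof.
move=> c2 Wg; have c0 := wiener_ge0 _ _ Wg.
apply: wiener_le (expR_sub1_le _ _) _; first by rewrite c0.
have E (K : fieldType) (x : K) : exp_sum 2 x = 1 + x.
  by rewrite /exp_sum !big_ord_recl big_ord0/= !divr1 expr0 expr1 addr0.
have := wiener_exp_sub 2 _ _ Wg.
by rewrite E opprD addrA; under eq_fun do rewrite E opprD addrA.
Qed.

(* Newton's iteration for [log (cexp g)]: the corrections [D = cexp (g - M) - 1]
satisfy [D' = (1 + D) e^(-D) - 1 = O(D^2)], in the Wiener norm as well as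
pointwise. *)
Lemma wiener_log d g : d <= 8^-1 -> (forall t, normc (g t) <= 4^-1) ->
  wiener d (fun t => cexp (g t) - 1) -> wiener (2 * d) g.
Proof.
move=> d8 g4 Wd; have d0 := wiener_ge0 _ _ Wd.
(* The Wiener bound for [M] is the geometric sum of the corrections [d / 2^k], [k < n]. The
   pointwise invariant fixes the branch: a small [cexp (g - M) - 1] determines [g - M] only modulo
   [2 pi i]. *)
have step n : exists M, [/\ wiener (2 * d - d / 2 ^+ n *+ 2) M,
    wiener (d / 2 ^+ n) (fun t => cexp (g t - M t) - 1) &
    forall t, normc (g t - M t) <= 4^-1 / 2 ^+ n].
  elim: n => [|n [M [WM WD gM]]].
    exists (fun=> 0); split.
    - by rewrite expr0 divr1 mulr_natl subrr; exact: wiener0.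
    - by rewrite expr0 divr1; under eq_fun do rewrite subr0.
    - by move=> t; rewrite expr0 divr1 subr0.
  pose D t := cexp (g t - M t) - 1.
  have n0 : (0 < 2 ^+ n :> R) by rewrite exprn_gt0.
  have n1 : 1 <= 2 ^+ n :> R by rewrite exprn_ege1// ler1n.
  set e := d / 2 ^+ n in WM WD *.
  have e0 : 0 <= e by rewrite divr_ge0// ltW.
  have e8 : e <= 8^-1.
    by rewrite (le_trans _ d8)// ler_pdivrMr// ler_peMr.
  have eS : d / 2 ^+ n.+1 = e / 2 by rewrite exprSr invfM mulrA.
  exists (fun t => M t + D t); split.
  - rewrite eS; apply: wiener_le (wienerD _ _ _ _ WM WD).
    by rewrite -[e *+ 2]mulr_natl -[(e / 2) *+ 2]mulr_natl; lra.
  - have WN := wienerN _ _ WD.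
    have W1 := wiener_exp1 _ _ (le_trans e8 _) WN.
    have {}W1 := W1 ltac:(lra).
    have W2 := wienerD _ _ _ _ (wienerM _ _ _ _ WD (wienerB _ _ _ _ W1 WD)) W1.
    rewrite eS.
    (* [W2] splits [(1 + D) e^(-D) - 1] as [D (e^(-D) - 1) + (e^(-D) - 1 + D)]; for [e <= 1/8] the
       bound [2e^3 + 3e^2] is at most [e / 2]. *)
    apply: (@wiener_le (e * (2 * e ^+ 2 + e) + 2 * e ^+ 2)); first by nra.
    move: W2; congr (wiener _ _); apply/funext => t.
    have -> : g t - (M t + D t) = (g t - M t) - D t by ring.
    rewrite (cexpD _ (- D t)) -/(D t) (_ : cexp (g t - M t) = 1 + D t); last by rewrite /D; ring.
    ring.
  (* The new pointwise error is [2|z|^2 <= |z| / 2], as [|z| <= 1/4]. *)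
  - move=> t; set z := g t - M t.
    have -> : g t - (M t + D t) = - (cexp z - 1 - z).
      by rewrite /D -/z /z; ring.
    have zn := gM t; rewrite -/z in zn.
    have z4 : normc z <= 4^-1.
      by rewrite (le_trans zn)// ler_pdivrMr// ler_peMr.
    rewrite normcN (le_trans (normc_cexp1_le _ _))//; first by lra.
    have -> : 4^-1 / 2 ^+ n.+1 = 4^-1 / 2 ^+ n / 2 :> R.
      by rewrite exprSr invfM mulrA.
    have := normc_ge0 z.
    by set x := _ / _ in zn *; nra.
apply: wiener_lim => e e0.
have [n ne] : exists n, 4^-1 / 2 ^+ n <= e.
  have : (fun n => 4^-1 / 2 ^+ n : R) @ \oo --> 0.
    rewrite -[0](mulr0 4^-1); apply: cvgMr.
    under eq_fun do rewrite -exprVn.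
    by apply: cvg_expr; rewrite ger0_norm// invf_lt1// ltr1n.
  move=> /cvgrPdist_le /(_ _ e0)[n _ /(_ n (leqnn n))] /= h.
  by exists n; rewrite (le_trans _ h)// sub0r normrN ler_norm.
have [M [WM _ gM]] := step n; exists M; last by move=> t; exact: le_trans ne.
by apply: wiener_le WM; rewrite gerBl mulrn_wge0// divr_ge0// exprn_ge0.
Qed.

End absolutely_convergent_trigonometric_sums.

(** * Recovering coefficients from the function *)

Section fourier_coefficients.
Local Open Scope complex_scope.
Context {R : realType}.
Implicit Types (P : seq (R * R)) (B : {fset R}) (g h : R -> R[i]) (a b : R -> R).

(* Averaging [g] and [t |-> e^(-ihu) g (t + h)] with [h = pi / (x - u)] keeps the
coefficient at [u], kills the one at [x] and does not increase the sup norm;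
[Q] is the multiplier of the composition of these averages. *)
Lemma averaging_multiplier (l : seq R) (u : R) : u \notin l ->
  exists Q : R -> R[i], [/\ Q u = 1, forall x, x \in l -> Q x = 0 &
    forall P s, (forall t, normc (trig_eval P t) <= s) ->
      forall t, normc (\sum_(q <- P) q.1%:C * Q q.2 * expi q.2 t) <= s].
Proof.
elim: l => [_|x l IH].
  exists (fun=> 1); split=> // P s Ps t.
  by under eq_bigr do rewrite mulr1; exact: Ps.
rewrite in_cons negb_or => /andP[ux /IH[Q [Qu Ql Qs]]].
have xu0 : x - u != 0 by rewrite subr_eq0 eq_sym.
pose h := pi / (x - u).
exists (fun y => Q y * ((1 + expi (y - u) h) / 2)); split.
- by rewrite Qu subrr expi0 mul1r -[1 + 1]/(2%:R) divff ?pnatr_eq0.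
- move=> y; rewrite in_cons => /predU1P[->|/Ql ->]; last by rewrite mul0r.
  rewrite /expi /h divfK// (_ : cexp _ = -1) ?subrr ?mul0r ?mulr0//.
  by rewrite /cexp/=; simpc; rewrite expR0 cospi sinpi; simpc.
- move=> P s Ps t.
  have -> : \sum_(q <- P) q.1%:C * (Q q.2 * ((1 + expi (q.2 - u) h) / 2)) * expi q.2 t
      = 2^-1 * ((\sum_(q <- P) q.1%:C * Q q.2 * expi q.2 t) +
        expi (- u) h * \sum_(q <- P) q.1%:C * Q q.2 * expi q.2 (h + t)).
    rewrite mulr_sumr -big_split/= mulr_sumr; apply: eq_bigr => q _.
    by rewrite expiD expiDt; ring.
  rewrite Normc.normcM normcVnat ler_pdivrMl// mulr_natl mulr2n.
  rewrite (le_trans (le_normcD _ _))// lerD ?Qs//.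
  by rewrite Normc.normcM normc_expi mul1r Qs.
Qed.

Definition trig_coef P u := \sum_(q <- P | q.2 == u) q.1.

(** The multiplier that kills every frequency of [P] other than [u] leaves the single coefficient,
    read off at [t = 0]. *)
Lemma trig_coef_le P s u :
  (forall t, normc (trig_eval P t) <= s) -> `|trig_coef P u| <= s.
Proof.
move=> Ps; pose l := [seq q.2 | q <- P & q.2 != u].
have ul : u \notin l by apply/mapP => -[q]; rewrite mem_filter => /andP[/eqP qu _] /esym.
have [Q [Qu Ql Qs]] := averaging_multiplier l u ul.
rewrite -normc_real; suff -> : (trig_coef P u)%:C =
  \sum_(q <- P) q.1%:C * Q q.2 * expi q.2 0 by exact: Qs.
rewrite /trig_coef rmorph_sum/= big_mkcond/=; apply: eq_big_seq => q qP.
rewrite expi_0 mulr1; case: eqP => [->|/eqP qu]; first by rewrite Qu mulr1.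
rewrite Ql ?mulr0//; apply/mapP; exists q => //.
by rewrite mem_filter qu.
Qed.

Definition trig_of B a := [seq (a x, x) | x <- B].

Lemma trig_eval_of B a t :
  trig_eval (trig_of B a) t = \sum_(x <- B) (a x)%:C * expi x t.
Proof. by rewrite /trig_eval big_map. Qed.

Lemma trig_norm_of B a : trig_norm (trig_of B a) = \sum_(x <- B) `|a x|.
Proof. by rewrite /trig_norm big_map. Qed.

Lemma trig_coef_of B a x : x \in B -> trig_coef (trig_of B a) x = a x.
Proof.
move=> xB; rewrite /trig_coef big_map/= big_mkcond (big_fsetD1 x)//= eqxx.
rewrite big_seq big1 ?addr0// => y; rewrite !inE => /andP[/negbTE -> //].
Qed.

Lemma trig_coef_cat P P' x : trig_coef (P ++ P') x = trig_coef P x + trig_coef P' x.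
Proof. by rewrite /trig_coef big_cat. Qed.

Lemma trig_eval_cat P P' t : trig_eval (P ++ P') t = trig_eval P t + trig_eval P' t.
Proof. by rewrite /trig_eval big_cat. Qed.

Definition trig_opp P : seq (R * R) := [seq (- q.1, q.2) | q <- P].

Lemma trig_coef_opp P x : trig_coef (trig_opp P) x = - trig_coef P x.
Proof. by rewrite /trig_coef big_map/= sumrN. Qed.

Lemma trig_eval_opp P t : trig_eval (trig_opp P) t = - trig_eval P t.
Proof.
rewrite /trig_eval big_map/= -sumrN; apply: eq_bigr => q _.
by rewrite rmorphN mulNr.
Qed.

Lemma sum_trig_coef_le P B : \sum_(x <- B) `|trig_coef P x| <= trig_norm P.
Proof.
apply: (@le_trans _ _ (\sum_(x <- B) \sum_(q <- P | q.2 == x) `|q.1|)).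
  by apply: ler_sum => x _; exact: ler_norm_sum.
under eq_bigr do rewrite big_mkcond.
rewrite exchange_big/=; apply: ler_sum => q _.
rewrite -big_mkcond/=; have [qB|qB] := boolP (q.2 \in B).
  rewrite big_mkcond (big_fsetD1 q.2)//= eqxx big_seq big1 ?addr0// => y.
  by rewrite !inE => /andP[+ _]; rewrite eq_sym => /negbTE ->.
rewrite big_seq_cond big1// => y /andP[yB /eqP qy].
by rewrite qy yB in qB.
Qed.

(** Uniform convergence of the net of partial sums over finite sets of frequencies; absolute
    summability of [a] is a separate matter. *)
Definition fourier_sum g a := forall e, 0 < e -> exists B, forall B',
  (B `<=` B')%fset -> forall t, normc (g t - \sum_(x <- B') (a x)%:C * expi x t) <= e.

Lemma fourier_sumB g h a b : fourier_sum g a -> fourier_sum h b ->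
  fourier_sum (fun t => g t - h t) (fun x => a x - b x).
Proof.
move=> ga hb e e0; have e2 : 0 < e / 2 by rewrite divr_gt0.
have [B gB] := ga _ e2; have [C hC] := hb _ e2.
exists (B `|` C)%fset => B'; rewrite fsubUset => /andP[BB' CB'] t.
have -> : \sum_(x <- B') (a x - b x)%:C * expi x t =
    \sum_(x <- B') (a x)%:C * expi x t - \sum_(x <- B') (b x)%:C * expi x t.
  rewrite -sumrB; apply: eq_bigr => x _.
  by rewrite rmorphB mulrBl.
have -> : forall u v w z : R[i], u - v - (w - z) = (u - w) - (v - z) by move=> *; ring.
by rewrite [leRHS]splitr (le_trans (le_normcD _ _))// normcN lerD ?gB ?hC.
Qed.

Lemma fourier_sum_wiener g a c : fourier_sum g a ->
  (forall B, \sum_(x <- B) `|a x| <= c) -> wiener c g.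
Proof.
move=> ga ac e /ga[B gB]; exists (trig_of B a); first by rewrite trig_norm_of.
by move=> t; rewrite trig_eval_of gB.
Qed.

Lemma fourier_coef_le g a s x : fourier_sum g a ->
  (forall t, normc (g t) <= s) -> `|a x| <= s.
Proof.
move=> ga gs; apply/ler_addgt0Pr => e /ga[B gB].
rewrite -(trig_coef_of (x |` B) a)%fset ?fset1U1//; apply: trig_coef_le => t.
rewrite trig_eval_of (le_trans (normc_le_dist _ (g t)))// addrC lerD//.
by rewrite normc_distC gB// fsubsetU1.
Qed.

(** Converse of [fourier_sum_wiener]. A partial sum of [g] and a Wiener approximant [P] are
    uniformly close, hence so are their individual coefficients, and those of [P] have l^1 norm at
    most [c]. *)
Lemma fourier_sum_le g a c B : fourier_sum g a -> wiener c g ->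
  \sum_(x <- B) `|a x| <= c.
Proof.
move=> ga Wg; apply/ler_addgt0Pr => e e0.
(* An error of [e / n] at each of the fewer than [n] points of [B] adds up to at most [e]. *)
pose n : R := (size B)%:R + 1; have n0 : 0 < n by rewrite ltr_wpDl.
have d0 : 0 < e / n / 2 by rewrite !divr_gt0.
have [C gC] := ga _ d0; have [P Pc gP] := Wg _ d0.
pose B' := (B `|` C)%fset.
have PB t : normc (trig_eval (trig_of B' a ++ trig_opp P) t) <= e / n.
  rewrite trig_eval_cat trig_eval_opp (le_trans (normc_dist_trans _ (g t) _))//.
  by rewrite [leRHS]splitr lerD// normc_distC trig_eval_of gC// fsubsetUr.
have coef x : x \in B -> `|a x| <= `|trig_coef P x| + e / n.
  move=> xB; have := trig_coef_le _ _ x PB.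
  rewrite trig_coef_cat trig_coef_opp trig_coef_of ?inE ?xB//.
  by move=> h; rewrite -lerBlDl (le_trans (lerB_dist _ _)).
rewrite big_seq (le_trans (ler_sum _ coef))// -big_seq big_split/=.
rewrite lerD//; first exact: le_trans (sum_trig_coef_le _ _) Pc.
rewrite big_const_seq count_predT iter_addr_0 -mulr_natr mulrAC ler_pdivrMr//.
by rewrite ler_pM2l// lerDl.
Qed.

End fourier_coefficients.

(** * Unordered sums and their finite approximations *)

Section unordered_sums.
Context {R : realType} {T : choiceType}.
Implicit Types (A : set T) (B C : {fset T}) (f b : T -> R).

Lemma esum_le_fset A f c : (forall x, 0 <= f x) ->
  (forall B, [set` B] `<=` A -> \sum_(x <- B) f x <= c) ->
  (\esum_(x in A) (f x)%:E <= c%:E)%E.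
Proof.
move=> f0 fc; apply: ge_ereal_sup => _ [F [finF FA] <-].
rewrite fsbig_finite//= sumEFin lee_fin fc// => x /=.
by rewrite in_fset_set// inE => /FA.
Qed.

Lemma fset_le_esum A f B : (forall x, 0 <= f x) -> [set` B] `<=` A ->
  ((\sum_(x <- B) f x)%:E <= \esum_(x in A) (f x)%:E)%E.
Proof.
move=> f0 BA; apply: ereal_sup_ubound; exists [set` B]; first by split.
by rewrite fsbig_finite//= set_fsetK sumEFin.
Qed.

Lemma fsumID f B C :
  \sum_(x <- C) f x = \sum_(x <- (C `&` B)%fset) f x + \sum_(x <- (C `\` B)%fset) f x.
Proof.
rewrite (big_fsetID _ (mem B) C)/=; congr (_ + _).
  by apply: eq_fbigl => x; rewrite !inE.
by apply: eq_fbigl => x; rewrite !inE andbC.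
Qed.

Lemma ler_fsum_subset f B C : (forall x, 0 <= f x) -> (B `<=` C)%fset ->
  \sum_(x <- B) f x <= \sum_(x <- C) f x.
Proof.
by move=> f0 /fsetIidPr BC; rewrite (fsumID f B C) BC lerDl sumr_ge0.
Qed.

(** A finite set whose sum is within [e] of the supremum leaves at most [e] for any disjoint set. *)
Lemma fsum_tail f L : (forall x, 0 <= f x) -> (forall B, \sum_(x <- B) f x <= L) ->
  forall e, 0 < e -> exists B, forall C, [disjoint C & B]%fset -> \sum_(x <- C) f x <= e.
Proof.
move=> f0 fL e e0; pose E := range (fun B => \sum_(x <- B) f x).
have supE : has_sup E.
  split; first by exists (\sum_(x <- fset0) f x), fset0.
  by exists L => _ [B _ <-].
have [_ [B _ <-] hB] := sup_adherent e0 supE.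
exists B => C /fsetDidPl CB; have : \sum_(x <- (C `|` B)%fset) f x <= sup E.
  by apply: sup_upper_bound => //; exists (C `|` B)%fset.
rewrite (fsumID f B) fsetIUl fsetIid fsetDUl fsetDv fsetU0 CB.
rewrite (fsetUidPr _ _ (fsubsetIr _ _)) => h.
by rewrite -(lerD2l (\sum_(x <- B) f x)) (le_trans h)// -lerBlDr ltW.
Qed.

Lemma fsum_tailD f B C e : (forall x, 0 <= f x) ->
  (forall C, [disjoint C & B]%fset -> \sum_(x <- C) f x <= e) ->
  \sum_(x <- C) f x <= \sum_(x <- B) f x + e.
Proof.
move=> f0 hB; rewrite (fsumID f B) lerD ?ler_fsum_subset ?fsubsetIr// hB//.
by apply/fsetDidPl; rewrite fsetDDl fsetUid.
Qed.

Lemma rsum_setT A b : rsum A b = rsum setT (fun x => if x \in A then b x else 0).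
Proof.
rewrite /rsum [X in (X - _)%E]esum_mkcond [X in (_ - X)%E]esum_mkcond.
congr (fine (_ - _)); apply: eq_esum => x _; rewrite !(funeposE, funenegE)/=;
  have [xA|/negbTE xA] := boolP (x \in A); rewrite ?xA ?oppr0 ?maxxx//.
Qed.

(** The sums of the positive and of the negative part each exceed their restriction to [C] by an
    amount in [[0, e]]; these amounts are subtracted, so the total error is [e] and not [2e]. *)
Lemma rsum_approx f B b e : (forall x, `|b x| <= f x) ->
  (forall C, [disjoint C & B]%fset -> \sum_(x <- C) f x <= e) ->
  forall C, (B `<=` C)%fset -> `|rsum setT b - \sum_(x <- C) b x| <= e.
Proof.
move=> bf hB C BC.
pose bp x := Num.max (b x) 0; pose bn x := Num.max (- b x) 0.
have bp0 x : 0 <= bp x by rewrite le_max lexx orbT.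
have bn0 x : 0 <= bn x by rewrite le_max lexx orbT.
have key c : (forall x, 0 <= c x) -> (forall x, c x <= f x) ->
    exists2 s, (\esum_(x in setT) (c x)%:E = s%:E)%E &
      \sum_(x <- C) c x <= s <= \sum_(x <- C) c x + e.
  move=> c0 cf.
  have u : (\esum_(x in setT) (c x)%:E <= (\sum_(x <- C) c x + e)%:E)%E.
    apply: esum_le_fset => // D _; apply: fsum_tailD => // D' D'C.
    apply: (@le_trans _ _ (\sum_(x <- D') f x)); first exact: ler_sum.
    by apply: hB; exact: fdisjointWr D'C.
  have l := fset_le_esum setT c C c0 (@subsetT _ _).
  have /fineK s : \esum_(x in setT) (c x)%:E \is a fin_num.
    by rewrite fin_numElt (lt_le_trans _ l) ?ltNyr// (le_lt_trans u) ?ltry.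
  exists (fine (\esum_(x in setT) (c x)%:E)); first by rewrite s.
  by rewrite -!lee_fin s l.
have [|p pE /andP[p1 p2]] := key bp bp0.
  by move=> x; rewrite ge_max (le_trans (ler_norm _) (bf x)) (le_trans _ (bf x)).
have [|n nE /andP[n1 n2]] := key bn bn0.
  move=> x; rewrite ge_max (le_trans _ (bf x)) ?(le_trans _ (bf x))//.
  by rewrite -normrN ler_norm.
have -> : rsum setT b = p - n.
  rewrite /rsum -[p - n]/(fine (p%:E - n%:E)) -pE -nE.
  by congr (fine (_ - _)); apply: eq_esum => x _; rewrite !(funeposE, funenegE)/= EFin_max.
have -> : \sum_(x <- C) b x = \sum_(x <- C) bp x - \sum_(x <- C) bn x.
  rewrite -sumrB; apply: eq_bigr => x _; rewrite /bp /bn.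
  by case: (leP (b x) 0) => b0; case: (leP (- b x) 0) => b1; lra.
rewrite ler_norml; lra.
Qed.

End unordered_sums.

(** * The spectral exponent as a Fourier sum *)

Section spectral_sum.
Local Open Scope complex_scope.
Context {R : realType}.

(** Expanding [lambda_u (e^(itu) - 1)] moves minus the sum of all [lambda_u] to frequency [0], which
    becomes the value [a 0]. *)
Lemma fourier_sum_csum (S : set R) (lambda : R -> R) :
  (forall u, ~ S u -> lambda u = 0) -> summable (S `\ 0) (EFin \o lambda) ->
  exists a : R -> R, [/\ forall u, u != 0 -> a u = lambda u,
    exists L, forall B : {fset R}, \sum_(x <- B) `|a x| <= L &
    fourier_sum (fun t => csum (S `\ 0)
      (fun u => (lambda u)%:C * (cexp ('i%C * (t * u)%:C) - 1))) a].
Proof.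
move=> lamS lamsum; set A := S `\ 0.
pose l u := if u \in A then lambda u else 0.
have l0 : l 0 = 0.
  by rewrite /l; case: ifPn => //; rewrite inE => -[_] /(_ erefl).
have lE u : u != 0 -> l u = lambda u.
  move=> u0; rewrite /l; case: ifPn => // /negP uA.
  rewrite lamS// => Su; apply: uA; rewrite inE; split => // /= uu.
  by rewrite uu eqxx in u0.
have lL (B : {fset R}) : \sum_(x <- B) `|l x| <= fine (\esum_(x in A) `|(EFin \o lambda) x|)%E.
  rewrite -lee_fin fineK; last by rewrite -summableE.
  rewrite esum_mkcond (_ : (fun x => _) = fun x => `|l x|%:E).
    exact: fset_le_esum.
  by apply/funext => x; rewrite /l; case: ifP => //=; rewrite normr0.
pose r := rsum setT l.
pose a u := if u == 0 then - r else l u.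
have aE u : u != 0 -> a u = l u by rewrite /a => /negbTE ->.
have sumaE (B : {fset R}) : (0 : R) \in B ->
    \sum_(x <- B) `|a x| = `|r| + \sum_(x <- B) `|l x|.
  move=> B0; rewrite (big_fsetD1 0)//= [in RHS](big_fsetD1 0)//= l0 normr0 add0r.
  rewrite /a eqxx normrN; congr (_ + _); rewrite big_seq [RHS]big_seq.
  by apply: eq_bigr => x; rewrite !inE => /andP[/negbTE -> _].
exists a; split.
- by move=> u u0; rewrite aE ?lE.
- exists (`|r| + fine (\esum_(x in A) `|(EFin \o lambda) x|)%E) => B.
  apply: (@le_trans _ _ (\sum_(x <- (0 |` B)%fset) `|a x|)).
    by apply: ler_fsum_subset => //; exact: fsubsetU1.
  by rewrite sumaE ?fset1U1// lerD2l.
(* The tail [e / 8] is doubled by [|e^(itu) - 1| <= 2] and doubled again by treating real and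
   imaginary parts separately; the constant term costs another [e / 8]. *)
- move=> e e0; have e8 : 0 < e / 8 by rewrite divr_gt0.
  have [B hB] := fsum_tail _ _ (fun x => normr_ge0 (l x)) lL _ e8.
  exists (0 |` B)%fset => B' B'B t.
  have B'0 : (0 : R) \in B' by apply: (fsubsetP B'B); rewrite fset1U1.
  have {}B'B : (B `<=` B')%fset by apply: fsubset_trans B'B; exact: fsubsetU1.
  have rB : `|r - \sum_(x <- B') l x| <= e / 8.
    exact: (rsum_approx (fun x => `|l x|) _ _ _ (fun=> lexx _) hB).
  have hB2 C : [disjoint C & B]%fset -> \sum_(x <- C) (2 * `|l x|) <= e / 4.
    by move=> /hB; rewrite -mulr_sumr; lra.
  have n2 u : normc (expi u t - 1) <= 2.
    by rewrite (le_trans (le_normcD _ _))// normcN normc_expi Normc.normc1.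
  have part (p : R[i] -> R) : (forall z, `|p z| <= normc z) -> p 0 = 0 ->
      (forall x z, p (x%:C * z) = x * p z) ->
      `|rsum A (fun u => p ((lambda u)%:C * (expi u t - 1))) -
        \sum_(x <- B') p ((l x)%:C * (expi x t - 1))| <= e / 4.
    move=> pn p0 pM; rewrite rsum_setT.
    rewrite (_ : (fun x => _) = fun x => p ((l x)%:C * (expi x t - 1))).
      apply: (rsum_approx (fun x => 2 * `|l x|) B) => // x.
      by rewrite pM normrM mulrC ler_wpM2r// (le_trans (pn _)).
    by apply/funext => x; rewrite /l; case: ifP => // _; rewrite mul0r.
  have {part}csumB : normc (csum A (fun u => (lambda u)%:C * (expi u t - 1)) -
      \sum_(x <- B') (l x)%:C * (expi x t - 1)) <= e / 2.
    rewrite (le_trans (normc_le_ReIm _))// ReB ImB Re_sum Im_sum.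
    rewrite (_ : e / 2 = e / 4 + e / 4); last by lra.
    rewrite lerD//; apply: part => //=.
    + exact: normr_Re_le.
    + by move=> x [c d] /=; rewrite mul0r subr0.
    + exact: normr_Im_le.
    + by move=> x [c d] /=; rewrite mul0r addr0.
  have -> : \sum_(x <- B') (a x)%:C * expi x t =
      \sum_(x <- B') (l x)%:C * (expi x t - 1) - (r - \sum_(x <- B') l x)%:C.
    have -> : \sum_(x <- B') (l x)%:C * (expi x t - 1) =
        \sum_(x <- B') (l x)%:C * expi x t - (\sum_(x <- B') l x)%:C.
      by rewrite rmorph_sum -sumrB; apply: eq_bigr => x _; rewrite mulrBr mulr1.
    rewrite rmorphB opprB addrA subrK.
    rewrite (big_fsetD1 0)//= [in RHS](big_fsetD1 0)//= l0 mul0r add0r expi0 mulr1.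
    rewrite {1}/a eqxx rmorphN addrC; congr (_ + _).
    rewrite big_seq [RHS]big_seq; apply: eq_bigr => x.
    by rewrite !inE => /andP[x0 _]; rewrite aE.
  rewrite opprB addrCA addrC (le_trans (le_normcD _ _))// normc_real; lra.
Qed.

End spectral_sum.

(** * Point masses, the Stieltjes integral and the characteristic function *)

Section point_masses.
Context {R : realType}.
Variable F : discrete_df R.

(** Masses indexed by location instead of by the enumeration of atoms, so that different
    distributions can be compared; injectivity of [atom] makes the choice of index harmless. *)
Definition pmass (x : R) : R :=
  if pselect (exists k, atom F k = x) is left e then mass F (projT1 (cid e)) else 0.

Lemma pmass_atom k : pmass (atom F k) = mass F k.
Proof.
rewrite /pmass; case: pselect => [e|[]]; last by exists k.
by case: cid => /= j /atom_inj ->.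
Qed.

Lemma pmass_out x : ~ range (atom F) x -> pmass x = 0.
Proof.
move=> Fx; rewrite /pmass; case: pselect => // -[k kx]; exfalso.
by apply: Fx; exists k.
Qed.

Lemma pmass_ge0 x : 0 <= pmass x.
Proof. by rewrite /pmass; case: pselect => // e; exact: mass_ge0. Qed.

Lemma nneseries_atom (h : R -> R) : (forall x, 0 <= h x) ->
  (\sum_(k <oo) (mass F k * h (atom F k))%:E = \esum_(x in setT) (pmass x * h x)%:E)%E.
Proof.
move=> h0; have ge0 k : (0 <= (mass F k * h (atom F k))%:E)%E.
  by rewrite lee_fin mulr_ge0 ?mass_ge0.
rewrite nneseries_esumT//.
under eq_esum do rewrite -pmass_atom.
rewrite -(esum_image setT (atom F) (fun x => (pmass x * h x)%:E)); last first.
  by move=> ? ? _ _ /atom_inj.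
rewrite esum_mkcond; apply: eq_esum => x _; case: ifPn => // /negP.
by rewrite inE => /pmass_out ->; rewrite mul0r.
Qed.

Lemma nneseries_mass : (\sum_(k <oo) (mass F k)%:E = 1)%E.
Proof.
have m1 := @mass_sum1 _ F.
rewrite -[1%E]/(1%:E) -(cvg_lim (@Rhausdorff R) m1) -EFin_lim; last first.
  by apply/cvg_ex; exists 1.
by congr (limn _); apply/funext => n /=; rewrite sumEFin.
Qed.

Lemma esum_pmass : (\esum_(x in setT) (pmass x)%:E = 1)%E.
Proof.
rewrite -nneseries_mass; have := nneseries_atom (fun=> 1) (fun=> ler01).
by under eq_eseriesr do rewrite mulr1; under [in X in _ = X -> _]eq_esum do rewrite mulr1.
Qed.

Lemma fsum_pmass_le1 (B : {fset R}) : \sum_(x <- B) pmass x <= 1.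
Proof.
by rewrite -lee_fin -[leRHS]esum_pmass; apply: fset_le_esum => //; exact: pmass_ge0.
Qed.

Lemma fsum_pmass_near1 e : 0 < e -> exists B : {fset R}, forall C : {fset R},
  [disjoint C & B]%fset -> \sum_(x <- C) pmass x <= e.
Proof. exact: fsum_tail pmass_ge0 fsum_pmass_le1 e. Qed.

Lemma fsum_pmass_ge (B : {fset R}) e : (forall C : {fset R},
  [disjoint C & B]%fset -> \sum_(x <- C) pmass x <= e) -> 1 - e <= \sum_(x <- B) pmass x.
Proof.
move=> hB; rewrite lerBlDr -lee_fin -[leLHS]esum_pmass.
apply: esum_le_fset => [x|C _]; first exact: pmass_ge0.
by apply: fsum_tailD => //; exact: pmass_ge0.
Qed.

Lemma df_rsum y : df F y = rsum setT (fun x => pmass x * step x y).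
Proof.
have ge0 x : 0 <= pmass x * step x y by rewrite mulr_ge0 ?pmass_ge0 ?ler0n.
rewrite /rsum [X in (_ - X)%E]esum1 ?sube0; last first.
  by move=> x _; rewrite funenegE/= max_r// lee_fin oppr_le0.
rewrite (@eq_esum _ _ _ _ (fun x => (pmass x * step x y)%:E)); last first.
  by move=> x _; rewrite funeposE/= max_l// lee_fin.
rewrite -nneseries_atom; last by move=> x; rewrite ler0n.
rewrite /df -[LHS]/(fine (_%:E)) -EFin_lim; last exact: is_cvg_df.
by congr (fine (limn _)); apply/funext => n /=; rewrite sumEFin.
Qed.

Lemma df_approx y e (B : {fset R}) :
  (forall C : {fset R}, [disjoint C & B]%fset -> \sum_(x <- C) pmass x <= e) ->
  forall C : {fset R}, (B `<=` C)%fset ->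
    `|df F y - \sum_(x <- C) pmass x * step x y| <= e.
Proof.
move=> hB C BC; rewrite df_rsum; apply: (rsum_approx pmass _ _ _ _ hB) => // x.
rewrite ger0_norm ?mulr_ge0 ?pmass_ge0 ?ler0n// ler_piMr ?pmass_ge0//.
by rewrite /step lern1; case: (_ <= _).
Qed.

Let delta (k : nat) : {measure set (measurableTypeR R) -> \bar R} :=
  mscale (NngNum (mass_ge0 F k)) (dirac (atom F k : measurableTypeR R)).

(** By uniqueness of the extension it suffices to compare the two measures on intervals []a, b]],
    where both give [df F b - df F a]. *)
Lemma lebesgue_stieltjes_df (A : set (measurableTypeR R)) : measurable A ->
  lebesgue_stieltjes_measure (df F) A = mseries delta 0 A.
Proof.
apply: lebesgue_stieltjes_measure_unique => X [[a b] _ /= <-].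
rewrite /lebesgue_stieltjes_measure /measure_extension measurable_mu_extE/=; last first.
  exact: is_ocitv.
have [ab|ba] := leP a b; last first.
  rewrite set_itv_ge ?bnd_simp -?leNgt ?ltW// wlength0.
  by rewrite [RHS]measure0.
rewrite wlength_itv_bnd//.
have E k : delta k `]a, b]%classic =
    (mass F k * step (atom F k) b - mass F k * step (atom F k) a)%:E.
  rewrite /delta/= /mscale/= diracE -mulrBr EFinM; congr (_ * _%:E)%E.
  rewrite mem_setE in_itv/= /step; have [ka|ak] := leP (atom F k) a.
    by rewrite (le_trans ka ab) subrr.
  by rewrite subr0.
rewrite /mseries; under eq_eseriesr do rewrite E.
have /cvg_lim <- : (fun n => series (fun k => mass F k * step (atom F k) b) n -
    series (fun k => mass F k * step (atom F k) a) n) @ \oo --> df F b - df F a.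
- by apply: cvgB; exact: is_cvg_df.
- rewrite -EFin_lim; last by apply: is_cvgB; exact: is_cvg_df.
  by congr (limn _); apply/funext => n /=; rewrite sumEFin sumrB.
- exact: Rhausdorff.
Qed.

Lemma ge0_integral_df (h : R -> R) : measurable_fun (setT : set (measurableTypeR R)) h ->
  (forall x, 0 <= h x) ->
  (\int[lebesgue_stieltjes_measure (df F)]_x (h x)%:E =
   \esum_(x in setT) (pmass x * h x)%:E)%E.
Proof.
move=> mh h0; rewrite -nneseries_atom//.
rewrite (@eq_measure_integral _ _ _ _ (mseries delta 0)); last first.
  by move=> A mA _; exact: lebesgue_stieltjes_df.
rewrite ge0_integral_measure_series//; last 2 first.
- by move=> x _; rewrite lee_fin.
- exact/measurable_EFinP.
apply: eq_eseriesr => k _; rewrite ge0_integral_mscale//; last 2 first.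
- exact/measurable_EFinP.
- by move=> x _; rewrite lee_fin.
by rewrite integral_dirac ?diracT ?mul1e//; exact/measurable_EFinP.
Qed.

Lemma Rintegral_df (h : R -> R) : measurable_fun (setT : set (measurableTypeR R)) h ->
  Rintegral (lebesgue_stieltjes_measure (df F)) setT h = rsum setT (fun x => pmass x * h x).
Proof.
move=> mh; rewrite /Rintegral /rsum integralE.
congr (fine (_ - _)).
  under eq_integral do rewrite funeposE/= -EFin_max.
  rewrite ge0_integral_df; last by move=> x; rewrite le_max lexx orbT.
    apply: eq_esum => x _; rewrite funeposE/= -EFin_max; congr (_%:E).
    by rewrite maxr_pMr ?pmass_ge0// mulr0.
  by apply: measurable_maxr => //; exact: measurable_cst.
under eq_integral do rewrite funenegE/= -EFin_max.
rewrite ge0_integral_df; last by move=> x; rewrite le_max lexx orbT.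
  apply: eq_esum => x _; rewrite funenegE/= -EFin_max; congr (_%:E).
  by rewrite maxr_pMr ?pmass_ge0// mulr0 mulrN.
apply: measurable_maxr => //.
exact: measurableT_comp.
Qed.

(** As [|e^(itx)| = 1], the tail of the series is bounded by the tail of the masses, uniformly in
    [t]. *)
Lemma fourier_sum_charfun : fourier_sum (charfun F) pmass.
Proof.
move=> e e0; have e2 : 0 < e / 2 by rewrite divr_gt0.
have [B hB] := fsum_pmass_near1 _ e2.
exists B => C BC t; rewrite (le_trans (normc_le_ReIm _))// ReB ImB Re_sum Im_sum.
have part (p : R[i] -> R) : (forall z, `|p z| <= normc z) ->
    (forall x z, p (x%:C%C * z) = x * p z) ->
    measurable_fun (setT : set (measurableTypeR R)) (fun x => p (expi x t)) ->
    `|Rintegral (lebesgue_stieltjes_measure (df F)) setT (fun x => p (expi x t)) -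
      \sum_(x <- C) p ((pmass x)%:C%C * expi x t)| <= e / 2.
  move=> pn pM mp; rewrite Rintegral_df//.
  under [X in _ - X]eq_bigr do rewrite pM.
  apply: (rsum_approx pmass _ _ _ _ hB) => // x.
  rewrite normrM ger0_norm ?pmass_ge0// ler_piMr ?pmass_ge0//.
  by rewrite (le_trans (pn _))// normc_expi.
rewrite [leRHS]splitr lerD//; apply: part.
- exact: normr_Re_le.
- by move=> x [c d] /=; rewrite mul0r subr0.
- under eq_fun do rewrite Re_expi; apply: measurableT_comp; last exact: mulrl_measurable.
  by apply: continuous_measurable_fun; exact: continuous_cos.
- exact: normr_Im_le.
- by move=> x [c d] /=; rewrite mul0r addr0.
- under eq_fun do rewrite Im_expi; apply: measurableT_comp; last exact: mulrl_measurable.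
  by apply: continuous_measurable_fun; exact: continuous_sin.
Qed.

End point_masses.

(** * Total variation versus the l^1 distance of point masses *)

Section total_variation_of_discrete_df.
Context {R : realType}.
Implicit Types (F G : discrete_df R).

Lemma step_mono (x y z : R) : y <= z -> step x y <= step x z.
Proof. by move=> yz; rewrite /step ler_nat; case: (leP x y) => // /le_trans ->. Qed.

Lemma df_diff_approx F G e : 0 < e -> exists B : {fset R}, forall C : {fset R},
  (B `<=` C)%fset -> forall y, `|(df F \- df G) y -
    \sum_(x <- C) (pmass F x - pmass G x) * step x y| <= e.
Proof.
move=> e0; have e2 : 0 < e / 2 by rewrite divr_gt0.
have [B hB] := fsum_pmass_near1 F _ e2; have [B' hB'] := fsum_pmass_near1 G _ e2.
exists (B `|` B')%fset => C; rewrite fsubUset => /andP[BC B'C] y.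
under eq_bigr do rewrite mulrBl.
rewrite sumrB /=.
set u := \sum_(_ <- _) _; set v := \sum_(_ <- _) _.
have -> : df F y - df G y - (u - v) = (df F y - u) - (df G y - v) by ring.
rewrite [leRHS]splitr (le_trans (ler_normB _ _))// lerD//.
  exact: df_approx hB _ BC.
exact: df_approx hB' _ B'C.
Qed.

Lemma total_variationR_le F G (c : R) :
  (forall B : {fset R}, \sum_(x <- B) `|pmass F x - pmass G x| <= c) ->
  (total_variationR (df F \- df G)%R <= c%:E)%E.
Proof.
move=> hc; apply: ge_ereal_sup => _ [a [b [ab ->]]].
apply: ge_ereal_sup => _ [_ [s [abs _] <-] <-]; rewrite lee_fin.
(* Each of the [size s] increments may be off by [e / m], half of it at each endpoint. *)
apply/ler_addgt0Pr => e e0; pose m : R := (size s)%:R + 1.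
have m0 : 0 < m by rewrite ltr_wpDl.
have d0 : 0 < e / m / 2 by rewrite !divr_gt0.
have [B hB] := df_diff_approx F G _ d0; have {}hB := hB B (fsubset_refl B).
(* [H] is nondecreasing with values in [[0, c]]; its increments dominate those of the finite
   approximation of [D] and telescope. *)
pose H y := \sum_(x <- B) `|pmass F x - pmass G x| * step x y.
set D := df F \- df G in hB *; pose S i := nth b (a :: s) i.
rewrite /variation/=.
apply: (@le_trans _ _ (\sum_(0 <= k < size s) ((H (S k.+1) - H (S k)) + e / m))).
  rewrite big_nat [leRHS]big_nat; apply: ler_sum => k /= ks.
  rewrite -/(S k) -/(S k.+1).
  have SS : S k <= S k.+1 by move/(pathP b) : abs => /(_ k ks) /ltW.
  have -> : D (S k.+1) - D (S k) =
      \sum_(x <- B) (pmass F x - pmass G x) * (step x (S k.+1) - step x (S k)) +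
      ((D (S k.+1) - \sum_(x <- B) (pmass F x - pmass G x) * step x (S k.+1)) -
       (D (S k) - \sum_(x <- B) (pmass F x - pmass G x) * step x (S k))).
    have -> : \sum_(x <- B) (pmass F x - pmass G x) * (step x (S k.+1) - step x (S k)) =
      \sum_(x <- B) (pmass F x - pmass G x) * step x (S k.+1) -
      \sum_(x <- B) (pmass F x - pmass G x) * step x (S k).
      by rewrite -sumrB; apply: eq_bigr => x _; rewrite mulrBr.
    by ring.
  rewrite (le_trans (ler_normD _ _))// lerD//.
    rewrite /H -sumrB (le_trans (ler_norm_sum _ _ _))//; apply: ler_sum => x _.
    by rewrite normrM -mulrBr ler_wpM2l// ger0_norm// subr_ge0 step_mono.
  by rewrite [leRHS]splitr (le_trans (ler_normB _ _))// lerD.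
rewrite big_split/= telescope_sumr// lerD//.
  apply: le_trans (hc B); rewrite lerBlDr -[leLHS]addr0 lerD//.
    apply: ler_sum => x _; rewrite ler_piMr//.
    by rewrite /step lern1; case: (_ <= _).
  by apply: sumr_ge0 => x _; rewrite mulr_ge0.
rewrite sumr_const_nat subn0 -mulr_natr mulrAC ler_pdivrMr// ler_pM2l//.
by rewrite lerDl.
Qed.

Lemma gap_below (l : seq R) (x : R) :
  exists2 h, 0 < h & forall z, z \in l -> z < x -> z <= x - h.
Proof.
elim: l => [|y l [h h0 hl]]; first by exists 1.
have [xy|yx] := leP x y.
  exists h => // z; rewrite in_cons => /predU1P[->|]; last exact: hl.
  by rewrite ltNge xy.
exists (Num.min h (x - y)); first by rewrite lt_min h0 subr_gt0.
move=> z; rewrite in_cons lerBrDr -lerBrDl ge_min => /predU1P[-> _|/hl zl /zl].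
  by rewrite lexx orbT.
by rewrite lerBrDr -lerBrDl => ->.
Qed.

(** For the [h] of [gap_below], no other approximating atom lies in []x - h, x]], so the increment
    of the finite approximation there is exactly the jump at [x]; an increment of the difference is
    at most its total variation. *)
Lemma pmass_dist_le F G x :
  (`|pmass F x - pmass G x|%:E <= total_variationR (df F \- df G)%R)%E.
Proof.
apply/lee_addgt0Pr => e e0; have e2 : 0 < e / 2 by rewrite divr_gt0.
have [B hB] := df_diff_approx F G _ e2; have {}hB := hB (x |` B)%fset (fsubsetU1 _ _).
have [h h0 hh] := gap_below (x |` B)%fset x.
set D := df F \- df G in hB *; pose d z := pmass F z - pmass G z.
apply: (@le_trans _ _ (`|D x - D (x - h)|%:E + e%:E)%E); last first.
  rewrite leeD2r//; apply: (@le_trans _ _ (total_variation (x - h) x D)).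
    by apply: total_variation_ge; rewrite gerBl ltW.
  by apply: ereal_sup_ubound; exists (x - h), x; rewrite gerBl ltW.
rewrite -EFinD lee_fin.
have dE : \sum_(z <- (x |` B)%fset) d z * step z x -
    \sum_(z <- (x |` B)%fset) d z * step z (x - h) = d x.
  rewrite -sumrB (big_fsetD1 x) ?fset1U1//= big_seq big1 => [|z].
    by rewrite /step lexx [x <= _]leNgt gtrBl h0/= mulr1 mulr0 subr0 addr0.
  rewrite !inE => /andP[zx zB]; rewrite -mulrBr /step.
  have [zlt|xz] := ltP z x; last first.
    rewrite leNgt lt_neqAle eq_sym zx xz/=.
    by rewrite leNgt (lt_le_trans _ xz) ?gtrBl// subrr mulr0.
  by rewrite (ltW zlt) hh ?subrr ?mulr0// !inE.
rewrite -/(d x) -dE.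
set A1 := \sum_(_ <- _) _; set A2 := \sum_(_ <- _) _.
have -> : A1 - A2 = (D x - D (x - h)) + (- (D x - A1) + (D (x - h) - A2)) by ring.
rewrite (le_trans (ler_normD _ _))// lerD2l [leRHS]splitr.
by rewrite (le_trans (ler_normD _ _))// normrN lerD// hB.
Qed.

Lemma near_all_seq (l : seq R) (P : R -> nat -> Prop) :
  (forall x, \forall n \near \oo, P x n) ->
  \forall n \near \oo, forall x, x \in l -> P x n.
Proof.
move=> hP; elim: l => [|x l IH]; first exact: filterE.
apply: filterS2 (hP x) IH => n Px Pl y.
by rewrite in_cons => /predU1P[->//|/Pl].
Qed.

(* Scheffe's lemma: since all total masses are [1], a finite set carrying almost
all of [F] carries almost all of [Fn n] as well. *)
Lemma pmass_cvg_l1 (Fn : nat -> discrete_df R) F :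
  (forall x e, 0 < e -> \forall n \near \oo, `|pmass (Fn n) x - pmass F x| <= e) ->
  forall e, 0 < e -> \forall n \near \oo, forall C : {fset R},
    \sum_(x <- C) `|pmass (Fn n) x - pmass F x| <= e.
Proof.
move=> ptw e e0; have e4 : 0 < e / 4 by rewrite divr_gt0.
have [B hB] := fsum_pmass_near1 F _ e4.
pose m : R := (size B)%:R + 1; have m0 : 0 < m by rewrite ltr_wpDl.
have d0 : 0 < e / 4 / m by rewrite divr_gt0.
have := near_all_seq B _ (fun x => ptw x _ d0).
apply: filterS => n near C.
have sumB : \sum_(x <- B) `|pmass (Fn n) x - pmass F x| <= e / 4.
  rewrite big_seq (le_trans (ler_sum _ near))// -big_seq.
  rewrite big_const_seq count_predT iter_addr_0.
  by rewrite -[leLHS]mulr_natr -[leRHS](divfK (lt0r_neq0 m0)) ler_pM2l// lerDl.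
rewrite (fsumID (fun x => `|pmass (Fn n) x - pmass F x|) B C).
have hC : [disjoint C `\` B & B]%fset by apply/fsetDidPl; rewrite fsetDDl fsetUid.
have h1 : \sum_(x <- (C `&` B)%fset) `|pmass (Fn n) x - pmass F x| <= e / 4.
  by apply: le_trans sumB; apply: ler_fsum_subset => //; exact: fsubsetIr.
have h2 : \sum_(x <- (C `\` B)%fset) `|pmass (Fn n) x - pmass F x| <=
    \sum_(x <- (C `\` B)%fset) pmass (Fn n) x + \sum_(x <- (C `\` B)%fset) pmass F x.
  rewrite -big_split; apply: ler_sum => x _.
  by rewrite (le_trans (ler_normB _ _))// !ger0_norm ?pmass_ge0.
have h3 := hB _ hC.
(* Budget: the part inside [B] costs [e / 4], the mass of [F] outside [B] another [e / 4]. The mass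
   of [Fn n] outside [B] is at most [1] minus its mass on [B], hence at most [e / 2]. *)
have h4 : \sum_(x <- B) pmass F x - \sum_(x <- B) pmass (Fn n) x <= e / 4.
  rewrite -sumrB (le_trans _ sumB)//; apply: ler_sum => x _.
  by rewrite -normrN opprB ler_norm.
have h5 := fsum_pmass_ge F B _ hB.
have h6 := fsum_pmass_le1 (Fn n) (B `|` C)%fset.
have h7 : \sum_(x <- (B `|` C)%fset) pmass (Fn n) x =
    \sum_(x <- B) pmass (Fn n) x + \sum_(x <- (C `\` B)%fset) pmass (Fn n) x.
  rewrite (fsumID (pmass (Fn n)) B) fsetIUl fsetIid fsetDUl fsetDv fset0U.
  by rewrite (fsetUidPl _ _ (fsubsetIr _ _)).
lra.
Qed.

End total_variation_of_discrete_df.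

(** * Comparing characteristic functions with spectral parameters *)

Section spectral_decomposition.
Local Open Scope complex_scope.
Context {R : realType}.
Implicit Types (F G : discrete_df R) (g h : R -> R[i]) (a b : R -> R).

Lemma wiener_charfun F : wiener 1 (charfun F).
Proof.
apply: (fourier_sum_wiener _ _ _ (fourier_sum_charfun F)) => B.
by under eq_bigr do rewrite ger0_norm ?pmass_ge0//; exact: fsum_pmass_le1.
Qed.

Lemma rsum0 (A : set R) : rsum A (fun=> 0) = 0 :> R.
Proof.
rewrite /rsum !esum1 ?sube0// => x _; rewrite ?(funeposE, funenegE)/=.
  by rewrite oppr0 maxxx.
by rewrite maxxx.
Qed.

Lemma spectral_decomposition F gamma lambda : spectral_parameters F gamma lambda ->
  exists g a, [/\ forall u, u != 0 -> a u = lambda u,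
    exists L, forall B : {fset R}, \sum_(x <- B) `|a x| <= L,
    fourier_sum g a, g 0 = 0 & forall t, charfun F t = expi gamma t * cexp (g t)].
Proof.
move=> [_ lam0 lamS fE]; have [a [al aL ga]] := fourier_sum_csum _ _ lam0 lamS.
eexists; exists a; split; [exact: al|exact: aL|exact: ga| |].
- rewrite /csum -[RHS]/(0 +i* 0).
  by congr (_ +i* _); rewrite -[RHS](rsum0 (zspan (growth_points F) `\ 0));
    congr (rsum _ _); apply/funext => u; rewrite mul0r mulr0 cexp0 subrr mulr0.
- by move=> t; rewrite fE cexpD.
Qed.

(** Continuity through the real-valued modulus, so that no topology on [R[i]] enters. *)
Definition continuousC g :=
  forall t e, 0 < e -> \forall s \near t, normc (g s - g t) <= e.

Lemma continuousC_expi x : continuousC (expi x).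
Proof.
move=> t e e0; have e2 : 0 < e / 2 by rewrite divr_gt0.
have ct : {for t, continuous (fun s : R => s * x)} by exact: mulrr_continuous.
have cc : {for t, continuous (fun s : R => cos (s * x))}.
  by apply: continuous_comp => //; exact: continuous_cos.
have cs : {for t, continuous (fun s : R => sin (s * x))}.
  by apply: continuous_comp => //; exact: continuous_sin.
move/cvgrPdist_le : cc => /(_ _ e2) cc; move/cvgrPdist_le : cs => /(_ _ e2) cs.
apply: filterS2 cc cs => s cc cs.
rewrite (le_trans (normc_le_ReIm _))// ReB ImB !Re_expi !Im_expi.
by rewrite [leRHS]splitr lerD// distrC.
Qed.

Lemma continuousCD g h : continuousC g -> continuousC h ->
  continuousC (fun t => g t + h t).
Proof.
move=> cg ch t e e0; have e2 : 0 < e / 2 by rewrite divr_gt0.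
apply: filterS2 (cg t _ e2) (ch t _ e2) => s gs hs.
by rewrite opprD addrACA [leRHS]splitr (le_trans (le_normcD _ _))// lerD.
Qed.

Lemma continuousC_trig P : continuousC (trig_eval P).
Proof.
elim: P => [|q P IH].
  move=> t e e0; apply: (@filterE _ (nbhs t)) => s.
  by rewrite /trig_eval !big_nil subrr Normc.normc0 ltW.
rewrite (_ : trig_eval _ = fun t => q.1%:C * expi q.2 t + trig_eval P t); last first.
  by apply/funext => t; rewrite /trig_eval big_cons.
apply: continuousCD => // t e e0.
have e1 : 0 < e / (`|q.1| + 1) by rewrite divr_gt0// ltr_wpDl.
apply: filterS (continuousC_expi q.2 t _ e1) => s; rewrite ler_pdivlMr ?ltr_wpDl//.
rewrite -mulrBr Normc.normcM normc_real; apply: le_trans.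
by rewrite mulrC ler_wpM2l ?normc_ge0// lerDl.
Qed.

Lemma continuousC_wiener c g : wiener c g -> continuousC g.
Proof.
move=> Wg t e e0; have e3 : 0 < e / 3 by rewrite divr_gt0.
have [P _ gP] := Wg _ e3; apply: filterS (continuousC_trig P t _ e3) => s Ps.
have -> : g s - g t = (g s - trig_eval P s) + (trig_eval P s - trig_eval P t) -
  (g t - trig_eval P t) by ring.
rewrite (le_trans (le_normcD _ _))// normcN.
have := le_normcD (g s - trig_eval P s) (trig_eval P s - trig_eval P t).
by have := gP s; have := gP t; lra.
Qed.

(** The linear part of the exponent is unbounded for nonzero [c], hence outside the Wiener class and
    treated separately. *)
Lemma continuousC_linear (c : R) : continuousC (fun t => 'i * (t * c)%:C).
Proof.
move=> t e e0; have e1 : 0 < e / (`|c| + 1) by rewrite divr_gt0// ltr_wpDl.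
have : \forall s \near t, `|t - s| <= e / (`|c| + 1).
  by move/cvgrPdist_le : (@cvg_id _ (nbhs t)); exact.
apply: filterS => s; rewrite ler_pdivlMr ?ltr_wpDl// distrC.
rewrite -mulrBr -rmorphB -mulrBl Normc.normcM normc_real normrM/=.
rewrite expr0n expr1n add0r sqrtr1 mul1r; apply: le_trans.
by rewrite ler_wpM2l// lerDl.
Qed.

Lemma continuous_normc g : continuousC g -> continuous (fun t => normc (g t)).
Proof.
move=> cg t; apply/cvgrPdist_le => e e0; apply: filterS (cg t _ e0) => s.
apply: le_trans; rewrite ler_norml.
have := normc_le_dist (g t) (g s); rewrite normc_distC.
by have := normc_le_dist (g s) (g t); lra.
Qed.

(* On [|z| <= 1/4] the bound [|cexp z - 1 - z| <= 2|z|^2] turns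
[|cexp z - 1| <= 1/16] into [|z| <= 1/8]; by continuity [|g|] cannot cross the
gap between [1/8] and [1/4]. *)
Lemma normc_log_le g : continuousC g -> g 0 = 0 ->
  (forall t, normc (cexp (g t) - 1) <= 16^-1) -> forall t, normc (g t) <= 8^-1.
Proof.
move=> cg g0 gs t.
have small s : normc (g s) <= 4^-1 -> normc (g s) <= 8^-1.
  move=> g4; have g2 : normc (g s) <= 2^-1 by lra.
  have := normc_cexp1_le (g s) g2; have := gs s.
  have := normc_le_dist (g s) (cexp (g s) - 1); rewrite normc_distC.
  by have := normc_ge0 (g s); nra.
apply: (small t); rewrite leNgt; apply/negP => gt4.
(* [3 / 16] is the midpoint of the forbidden gap. *)
suff [s gs3] : exists s, normc (g s) = 3 / 16.
  by have := small s; rewrite gs3; lra.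
have cN := continuous_normc _ cg.
have g00 : normc (g 0) = 0 by rewrite g0 Normc.normc0.
have [t0|t0] := leP 0 t.
  have [||s _ sE] := @IVT R (fun t => normc (g t)) 0 t (3 / 16) t0.
  - exact: continuous_subspaceT.
  - by rewrite g00 min_l ?max_r ?normc_ge0//; lra.
  - by exists s.
have [||s _ sE] := @IVT R (fun t => normc (g t)) t 0 (3 / 16) (ltW t0).
- exact: continuous_subspaceT.
- by rewrite g00 min_r ?max_l ?normc_ge0//; lra.
- by exists s.
Qed.

(** The two characteristic functions differ by the factor [e^z - 1] with [z = g - h]. Counting
    frequency [0] one has [|z| <= 2e <= 1/4], hence [|e^z - 1| <= |z| + 2|z|^2 <= 4e], and this sup
    bound passes to every point mass. *)
Lemma near_sup_charfun F G gamma g h a b e :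
  (forall t, charfun F t = expi gamma t * cexp (g t)) ->
  (forall t, charfun G t = expi gamma t * cexp (h t)) ->
  fourier_sum g a -> fourier_sum h b -> g 0 = 0 -> h 0 = 0 -> 8 * e <= 1 ->
  (forall B : {fset R}, 0 \notin B -> \sum_(x <- B) `|a x - b x| <= e) ->
  forall x, `|pmass F x - pmass G x| <= 4 * e.
Proof.
move=> fE hE ga hb g0 h0 e8 abe x.
have gh := fourier_sumB _ _ _ _ ga hb.
(* The hypothesis leaves out frequency [0]; since [g 0 = h 0], all differences sum to zero, so the
   one at [0] is balanced by the others. *)
have b0 : `|a 0 - b 0| <= e.
  apply/ler_addgt0Pr => d d0; have [B hB] := gh _ d0.
  have := hB (0 |` B)%fset (fsubsetU1 _ _) 0; rewrite g0 h0 subrr sub0r normcN.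
  under eq_bigr do rewrite expi_0 mulr1.
  rewrite -rmorph_sum normc_real (big_fsetD1 0) ?fset1U1//= => hd.
  have := abe ((0 |` B) `\ 0)%fset; rewrite !inE eqxx => /(_ isT).
  have := ler_norm_sum ((0 |` B) `\ 0)%fset (fun x => a x - b x) xpredT.
  move: hd; set s := \sum_(_ <- _) (a _ - b _) => hd.
  have := ler_normB (a 0 - b 0 + s) s; rewrite addrK; lra.
have ab (B : {fset R}) : \sum_(y <- B) `|a y - b y| <= 2 * e.
  apply: (@le_trans _ _ (\sum_(y <- (0 |` B)%fset) `|a y - b y|)).
    by apply: ler_fsum_subset => //; exact: fsubsetU1.
  rewrite (big_fsetD1 0) ?fset1U1//= mulr_natl mulr2n lerD//.
  by apply: abe; rewrite !inE eqxx.
have Wgh := fourier_sum_wiener _ _ _ gh ab.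
have fF := fourier_sum_charfun F; have fG := fourier_sum_charfun G.
apply: (fourier_coef_le _ _ _ x (fourier_sumB _ _ _ _ fF fG)) => t.
have -> : charfun F t - charfun G t = charfun G t * (cexp (g t - h t) - 1).
  have e1 : cexp (g t) = cexp (h t) * cexp (g t - h t).
    by rewrite -cexpD addrC subrK.
  by rewrite fE hE {1}e1; ring.
rewrite Normc.normcM; have n1 := wiener_bound _ _ t (wiener_charfun G).
have n2 := wiener_bound _ _ t Wgh.
set z := g t - h t in n2 *.
have z2 : normc z <= 2^-1 by lra.
have := normc_cexp1_le z z2; have := normc_le_dist (cexp z - 1) z.
have := normc_ge0 z; have := normc_ge0 (cexp z - 1); have := normc_ge0 (charfun G t).
move: n1 n2; set u := normc (charfun G t); set v := normc (cexp z - 1); set w := normc z.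
move=> u1 w2 u0 v0 w0 h1 h2.
have v4 : v <= 4 * e by nra.
by nra.
Qed.

(** [expR L] bounds the Wiener norm of the reciprocal of [charfun F]. The threshold [1/16] is the
    one of [normc_log_le] and lies below the [1/8] of [wiener_log], which also supplies the factor
    [2]. The conclusion is independent of [L'], so it is uniform when [G] runs through a
    sequence. *)
Lemma near_l1_spectral F G gamma gamma' g h a b L d :
  (forall t, charfun F t = expi gamma t * cexp (g t)) ->
  (forall t, charfun G t = expi gamma' t * cexp (h t)) ->
  fourier_sum g a -> fourier_sum h b -> g 0 = 0 -> h 0 = 0 ->
  (forall B : {fset R}, \sum_(x <- B) `|a x| <= L) ->
  (exists L', forall B : {fset R}, \sum_(x <- B) `|b x| <= L') ->
  16 * (d * expR L) <= 1 ->
  (forall B : {fset R}, \sum_(x <- B) `|pmass G x - pmass F x| <= d) ->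
  gamma' = gamma /\
  forall B : {fset R}, \sum_(x <- B) `|b x - a x| <= 2 * (d * expR L).
Proof.
move=> fE hE ga hb g0 h0 aL [L' bL'] dL pd.
have Wg := fourier_sum_wiener _ _ _ ga aL; have Wh := fourier_sum_wiener _ _ _ hb bL'.
have Winv : wiener (expR L) (fun t => expi (- gamma) t * cexp (- g t)).
  rewrite -[expR L]mul1r; apply: wienerM; first exact: wiener_expi.
  exact/wiener_exp/wienerN.
have Wd : wiener d (fun t => charfun G t - charfun F t).
  exact: fourier_sum_wiener (fourier_sumB _ _ _ _ (fourier_sum_charfun G)
    (fourier_sum_charfun F)) pd.
pose k t : R[i] := 'i * (t * (gamma' - gamma))%:C + (h t - g t).
have Wk : wiener (d * expR L) (fun t => cexp (k t) - 1).
  move: (wienerM _ _ _ _ Wd Winv); congr wiener; apply/funext => t.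
  have eg : expi gamma t * expi (- gamma) t = 1 by rewrite -expiD subrr expi0.
  have cg : cexp (g t) * cexp (- g t) = 1 by rewrite -cexpD subrr cexp0.
  rewrite /k [in RHS]cexpD [in RHS]cexpD -/(expi (gamma' - gamma) t) expiD fE hE.
  rewrite mulrBl mulrACA [X in _ - X]mulrACA eg cg mulr1; ring.
have kc : continuousC k.
  apply: continuousCD; first exact: continuousC_linear.
  exact: continuousC_wiener (wienerB _ _ _ _ Wh Wg).
have k0 : k 0 = 0 by rewrite /k mul0r mulr0 add0r h0 g0 subrr.
have k8 := normc_log_le k kc k0 _.
have {}k8 t : normc (k t) <= 8^-1.
  by apply: k8 => s; apply: le_trans (wiener_bound _ _ s Wk) _; lra.
have gE : gamma' = gamma.
  apply/eqP; rewrite -subr_eq0; apply/negP => /negP gg.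
  (* At [t = M / (gamma' - gamma)] the linear part of [k] has modulus [M], which exceeds the bound
     [L' + L] of the remaining part by more than [1/8]. *)
  pose M := 8^-1 + (L' + L) + 1.
  have := k8 (M / (gamma' - gamma)); rewrite /k divfK//.
  set t := M / _; have := wiener_bound _ _ t (wienerB _ _ _ _ Wh Wg).
  have -> : normc ('i * M%:C + (h t - g t)) = normc ('i * M%:C - (g t - h t)).
    by rewrite opprB.
  have := normc_le_dist ('i * M%:C) (g t - h t).
  rewrite [normc (g t - h t)]normc_distC Normc.normcM normc_real /=.
  rewrite expr0n expr1n add0r sqrtr1 mul1r.
  by have := ler_norm M; rewrite /M; lra.
have kE : k = fun t => h t - g t.
  by apply/funext => t; rewrite /k gE subrr mulr0 mulr0 add0r.
split=> // B; apply: (fourier_sum_le (fun t => h t - g t)).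
  exact: fourier_sumB.
rewrite -kE; apply: wiener_log => //; first by lra.
by move=> t; apply: le_trans (k8 t) _; lra.
Qed.

End spectral_decomposition.

(** * Assembly of the two implications *)

Lemma esum_spectral_dist {R : realType} (S S' : set R) (lambda lambda' : R -> R) :
  (forall u, ~ S u -> lambda u = 0) -> (forall u, ~ S' u -> lambda' u = 0) ->
  \esum_(u in (S' `|` S) `\ 0) `|lambda' u - lambda u|%:E =
  \esum_(u in setT) (if u == 0 then 0 else `|lambda' u - lambda u|)%:E.
Proof.
move=> S0 S'0; rewrite esum_mkcond; apply: eq_esum => u _.
case: ifPn => [|/negP]; rewrite inE.
  by move=> [_ /eqP/negbTE ->].
case: eqP => // u0 Su; rewrite S0 ?S'0 ?subrr ?normr0// => Su'; apply: Su; split=> //.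
  by left.
by right.
Qed.

Lemma cvge0P {R : realType} (u : nat -> \bar R) : (forall n, 0 <= u n)%E ->
  u n @[n --> \oo] --> 0%E <->
  forall e : R, 0 < e -> \forall n \near \oo, (u n <= e%:E)%E.
Proof.
move=> u0; split=> [/fine_cvgP[ufin /cvgrPdist_le uc] e e0|ue].
  apply: filterS2 ufin (uc _ e0) => n un /=.
  rewrite sub0r normrN ger0_norm ?fine_ge0// => une.
  by rewrite -(fineK un) lee_fin.
have ufin : \forall n \near \oo, u n \is a fin_num.
  by apply: filterS (ue _ ltr01) => n un; rewrite ge0_fin_numE// (le_lt_trans un) ?ltry.
apply/fine_cvgP; split=> //; apply/cvgrPdist_le => e e0.
apply: filterS2 ufin (ue _ e0) => n un une /=.
by rewrite sub0r normrN ger0_norm ?fine_ge0// -lee_fin fineK.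
Qed.

Theorem theorem4 (R : realType)
    (F : discrete_df R) (Fn : nat -> discrete_df R)
    (gamma : R) (lambda : R -> R) (gamman : nat -> R) (lambdan : nat -> R -> R)
    (FDS : DS F) (FnDS : forall n, DS (Fn n))
    (Fspec : spectral_parameters F gamma lambda)
    (Fnspec : forall n, spectral_parameters (Fn n) (gamman n) (lambdan n)) :
  cvg_in_variation Fn F <->
  (exists n0 : nat, forall n, (n0 <= n)%N -> gamman n = gamma) /\
  \esum_(u in (zspan (growth_points (Fn n)) `|` zspan (growth_points F)) `\ 0)
     `|lambdan n u - lambda u|%:E @[n --> \oo] --> 0%E.
Proof.
have [g [a [al [L aL] ga g0 fE]]] := spectral_decomposition _ _ _ Fspec.
have dec n := spectral_decomposition _ _ _ (Fnspec n).
have [_ lam0 _ _] := Fspec.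
(* The spectral representation does not fix the value at [0], so [dist] discards it; summing over
   all of [R] makes the index set independent of [n]. *)
pose dist n u := if u == 0 then 0 else `|lambdan n u - lambda u|.
have dist0 n u : 0 <= dist n u by rewrite /dist; case: ifP.
have -> : (fun n => \esum_(u in (zspan (growth_points (Fn n)) `|`
    zspan (growth_points F)) `\ 0) `|lambdan n u - lambda u|%:E) =
    (fun n => \esum_(u in setT) (dist n u)%:E).
  apply/funext => n; have [_ lamn0 _ _] := Fnspec n.
  exact: esum_spectral_dist lam0 lamn0.
have esum0 n : (0 <= \esum_(u in setT) (dist n u)%:E)%E.
  by apply: esum_ge0 => u _; rewrite lee_fin.
have TV0 n : (0 <= total_variationR (df (Fn n) \- df F)%R)%E.
  by apply: le_trans (pmass_dist_le (Fn n) F 0); rewrite lee_fin.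
rewrite /cvg_in_variation (cvge0P _ TV0) (cvge0P _ esum0); split.
- move=> TV.
  have l1 : forall e, 0 < e -> \forall n \near \oo, forall C : {fset R},
      \sum_(x <- C) `|pmass (Fn n) x - pmass F x| <= e.
    apply: pmass_cvg_l1 => x e e0; apply: filterS (TV _ e0) => n TVn.
    by rewrite -lee_fin (le_trans (pmass_dist_le _ _ _)).
  have key d : 0 < d -> 16 * (d * expR L) <= 1 -> \forall n \near \oo,
      gamman n = gamma /\ forall B : {fset R}, \sum_(u <- B) dist n u <= 2 * (d * expR L).
    move=> d0 dL; apply: filterS (l1 _ d0) => n pd.
    have [h [b [bl bL hb h0 hE]]] := dec n.
    have [gE abd] := near_l1_spectral _ _ _ _ _ _ _ _ _ _ fE hE ga hb g0 h0 aL bL dL pd.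
    split=> // B; apply: le_trans (abd B); apply: ler_sum => u _.
    by rewrite /dist; case: eqP => // /eqP u0; rewrite bl// al.
  have K0 := expR_gt0 L.
  split.
    have [||N _ hN] := key (16^-1 / expR L); first by rewrite divr_gt0.
      by rewrite divfK ?gt_eqF// divff.
    by exists N => n /hN[].
  (* [1/16] meets the threshold of [key] for [d = m / expR L]; [e / 2] makes its bound [2m] at most
     [e]. *)
  move=> e e0; pose m := Num.min (16^-1) (e / 2).
  have m0 : 0 < m by rewrite lt_min divr_gt0 ?invr_gt0 ?ltr0n.
  have [m1 m2] : m <= 16^-1 /\ m <= e / 2 by rewrite /m !ge_min !lexx orbT.
  have dm : m / expR L * expR L = m by rewrite divfK ?gt_eqF.
  have [||N _ hN] := key (m / expR L); first by rewrite divr_gt0.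
    by rewrite dm; lra.
  exists N => // n /hN[_ nB]; apply: esum_le_fset => // B _.
  by apply: le_trans (nB B) _; rewrite dm; lra.
- move=> [[N gE] lam] e e0.
  have ptw : forall x d, 0 < d -> \forall n \near \oo, `|pmass (Fn n) x - pmass F x| <= d.
    (* [near_sup_charfun] requires [8m <= 1] and yields [4m <= d]. *)
    move=> x d d0; pose m := Num.min (8^-1) (d / 4).
    have m0 : 0 < m by rewrite lt_min divr_gt0 ?invr_gt0 ?ltr0n.
    have [m1 m2] : m <= 8^-1 /\ m <= d / 4 by rewrite /m !ge_min !lexx orbT.
    have geN : \forall n \near \oo, (N <= n)%N by exact: nbhs_infty_ge.
    apply: filterS2 geN (lam _ m0) => n Nn lamn.
    have [h [b [bl bL hb h0 hE]]] := dec n; rewrite (gE n Nn) in hE.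
    apply: (@le_trans _ _ (4 * m)); last by lra.
    apply: (near_sup_charfun _ _ _ _ _ _ _ _ hE fE hb ga h0 g0); first by lra.
    move=> B B0; rewrite -lee_fin; apply: le_trans lamn.
    apply: le_trans (fset_le_esum setT (dist n) B (dist0 n) (@subsetT _ _)).
    rewrite lee_fin big_seq [leRHS]big_seq; apply: ler_sum => u uB.
    rewrite /dist; case: eqP => [u0|/eqP u0]; last by rewrite bl// al.
    by rewrite u0 (negbTE B0) in uB.
  apply: filterS (pmass_cvg_l1 _ _ ptw e e0) => n l1n.
  exact: total_variationR_le.
Qed.
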